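(* Let $G$ be a countable group and let $\mu$ be a probability measure on $G$ with finite Shannon entropy. Then the map \[ [2,\infty)\to[0,\infty),\qquad p\mapsto-p\log r_{\mathrm{PF}_q(G)}(\mu), \] where $\frac1p+\frac1q=1$, is increasing and bounded on $[2,\infty)$, and \[ \lim_{p\to\infty}-p\log r_{\mathrm{PF}_q(G)}(\mu)\le h(G,\mu). \]
   Context: Shannon entropy $H(G,\mu)=-\sum_s\mu(s)\log\mu(s)$; Avez entropy $h(G,\mu)=\lim_n\frac1nH(G,\mu^{*n})$ with $\mu^{*n}$ the $n$-fold convolution power ($f*g(s)=\sum_tf(t)g(t^{-1}s)$). For $1<q<\infty$, $\lambda_q:\ell^1(G)\to B(\ell^q(G))$, $\lambda_q(f)g=f*g$, and $\mathrm{PF}_q(G)$ is the norm closure of $\lambda_q(\ell^1(G))$ in $B(\ell^q(G))$; $r_{\mathrm{PF}_q(G)}(\mu)$ is the spectral radius of $\lambda_q(\mu)$ in $\mathrm{PF}_q(G)$. *)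

(* Defs.v *)
From HB Require Import structures.
From mathcomp Require Import all_boot all_order all_algebra.
From mathcomp Require Import all_classical all_reals all_analysis.
From mathcomp Require Import complex.
Set Implicit Arguments. Unset Strict Implicit. Unset Printing Implicit Defensive.
Import Order.TTheory GRing.Theory Num.Theory.
Import numFieldNormedType.Exports.
Local Open Scope classical_set_scope.
Local Open Scope ring_scope.
Delimit Scope complex_scope with C.

Record cgroup := CGroup {
  gcar :> countType;
  gmul : gcar -> gcar -> gcar;
  ginv : gcar -> gcar;
  gone : gcar;
  gmulA : forall x y z, gmul x (gmul y z) = gmul (gmul x y) z;
  gmul1 : forall x, gmul gone x = x;
  gmulV : forall x, gmul (ginv x) x = gone }.

Section Defs.
Variable R : realType.
Variable G : cgroup.
Local Notation C := (R[i]).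

Definition rsum (u : G -> R) : R :=
  fine (\esum_(s in [set: G]) (Num.max (u s) 0)%:E)
  - fine (\esum_(s in [set: G]) (Num.max (- u s) 0)%:E).

Definition csum (f : G -> C) : C :=
  Complex (rsum (fun s => complex.Re (f s))) (rsum (fun s => complex.Im (f s))).

Definition prob_measure (mu : G -> R) : Prop :=
  (forall s, 0 <= mu s) /\ (\esum_(s in [set: G]) (mu s)%:E = 1)%E.

(* Shannon entropy (with 0 log 0 = 0, since ln 0 = 0 in MathComp) *)
Definition shannon_esum (mu : G -> R) : \bar R :=
  \esum_(s in [set: G]) (- (mu s * ln (mu s)))%:E.
Definition finite_entropy (mu : G -> R) : Prop := (shannon_esum mu < +oo)%E.
Definition shannon (mu : G -> R) : R := fine (shannon_esum mu).

Definition rconv (f g : G -> R) : G -> R :=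
  fun s => rsum (fun t => f t * g (gmul (ginv t) s)).
Definition delta_e : G -> R := fun s => if s == gone G then 1 else 0.
Fixpoint convpow (mu : G -> R) (n : nat) : G -> R :=
  match n with 0 => delta_e | n'.+1 => rconv mu (convpow mu n') end.

Definition avez (mu : G -> R) : R :=
  lim ((fun n : nat => shannon (convpow mu n) / n%:R) @ \oo).

Definition lq (q : R) (f : G -> C) : Prop :=
  (\esum_(s in [set: G]) ((ComplexField.Normc.normc (f s)) `^ q)%:E < +oo)%E.
Definition lqnorm (q : R) (f : G -> C) : R :=
  (fine (\esum_(s in [set: G]) ((ComplexField.Normc.normc (f s)) `^ q)%:E)) `^ q^-1.
Definition l1 (f : G -> C) : Prop :=
  (\esum_(s in [set: G]) (ComplexField.Normc.normc (f s))%:E < +oo)%E.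

(* operators (only their action on l^q(G) matters) *)
Definition op := (G -> C) -> (G -> C).

Definition lambda (f : G -> C) : op :=
  fun g s => csum (fun t => f t * g (gmul (ginv t) s)).

Definition opnorm (q : R) (T : op) : \bar R :=
  ereal_sup [set (lqnorm q (T g))%:E | g in [set g | lq q g /\ lqnorm q g <= 1]].

Definition bounded_op (q : R) (T : op) : Prop :=
  [/\ (forall g, lq q g -> lq q (T g)),
      (forall (a : C) g h, lq q g -> lq q h ->
          T (fun s => a * g s + h s) = (fun s => a * T g s + T h s))
    & (opnorm q T < +oo)%E].

Definition PF (q : R) : set op :=
  [set T | bounded_op q T /\
     forall e : R, 0 < e -> exists f, l1 f /\
        (opnorm q (fun g s => (T g s - lambda f g s)%R) < e%:E)%E].

Definition invertible_PF (q : R) (T : op) : Prop :=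
  exists S, PF q S /\ (forall g, lq q g -> S (T g) = g)
                   /\ (forall g, lq q g -> T (S g) = g).

Definition spectrum_PF (q : R) (T : op) : set C :=
  [set z | ~ invertible_PF q (fun g s => z * g s - T g s)].

Definition specrad_PF (q : R) (T : op) : R :=
  fine (ereal_sup [set (ComplexField.Normc.normc z)%:E | z in spectrum_PF q T]).

Definition conj_exp (p : R) : R := p / (p - 1).
Definition rate (mu : G -> R) (p : R) : R :=
  - (p * ln (specrad_PF (conj_exp p) (lambda (fun s => ((mu s)%:C)%C)))).

End Defs.

(* Main.v *)
(* Let T be convolution by mu on l^q and a_n the q-th power of the norm of T^n
   on nonnegative functions; a_n is submultiplicative, so ln a_n / n tends to
   some l (Fekete).  Then e^(l/q) is the spectral radius of T in PF_q(G):
   outside the disc of that radius the Neumann series of the resolvent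
   converges in PF_q(G), while positivity of T puts r = e^(l/q) itself in the
   spectrum.  Indeed a bounded inverse of r - T would bound the partial sums of
   sum_n t^-(n+1) T^n uniformly for t > r near r, hence also their squares,
   whose N-th term carries a factor N+1, although a_N >= r^(qN).

   Thus the rate at p is -(p-1) l.  It is nonnegative because a_n <= 1,
   nondecreasing in p by interpolation between l^1 and l^q, and at most the
   Avez entropy because a_n >= sum_s mu^{*n}(s)^q >= exp(-(q-1) H(mu^{*n})). *)

Require Import Defs.
From HB Require Import structures.
From mathcomp Require Import all_boot all_order all_algebra.
From mathcomp Require Import all_classical all_reals all_analysis.
From mathcomp Require Import complex.
From mathcomp Require Import ring lra.
Set Implicit Arguments. Unset Strict Implicit. Unset Printing Implicit Defensive.
Import Order.TTheory GRing.Theory Num.Theory.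
Import numFieldNormedType.Exports.
Local Open Scope classical_set_scope.
Local Open Scope ring_scope.

(** * Nonnegative sums and Hoelder's inequality *)

(** Positivity replaces it, since it suffices to find one spectral point of modulus [r]. Of a
    hypothetical inverse of [r - T] only boundedness and the inverse identity are exploited: it is
    fed with partial sums of the series for [t > r], which have finite norm, so that a small
    multiple of their own norm can be absorbed.

    Almost all estimates are made on functions with values in [[0, +oo]], where sums always exist
    and can be exchanged; they reach complex functions through [|T g| <= T |g|]. With q-th powers of
    norms, one weighted Hoelder inequality yields contractivity of [T], interpolation and
    convergence of the Neumann series.

    Finite entropy enters twice. Besides the final bound, it makes every [a_n] positive and
    [ln a_n / n] bounded below, so that [l] is a real number, [r > 0], and no logarithm of [a_n]
    meets the default value of [ln 0]. *)

Section NonnegSums.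
Context {R : realType} {I : choiceType}.
Local Open Scope ereal_scope.
Implicit Types a b : I -> \bar R.

Lemma ge_esum1 a i : (forall j, 0 <= a j) -> a i <= \esum_(j in [set: I]) a j.
Proof.
move=> a0; apply: esum_ge; exists [set i]; last by rewrite fsbig_set1.
by split => //; exact: finite_set1.
Qed.

Lemma esum0_eq0 a i : (forall j, 0 <= a j) ->
  \esum_(j in [set: I]) a j = 0 -> a i = 0.
Proof.
move=> a0 s0; apply/eqP; rewrite eq_le a0 andbT -s0; exact: ge_esum1.
Qed.

Lemma esum_lty_fin a i : (forall j, 0 <= a j) ->
  \esum_(j in [set: I]) a j < +oo -> a i \is a fin_num.
Proof.
by move=> a0 s; rewrite ge0_fin_numE// (le_lt_trans _ s)// ge_esum1.
Qed.

(** For finite [c > 0] the inequality [<=] suffices: applied to [c^-1] it gives the converse. For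
    [c = +oo] a single nonzero term already makes both sides infinite. *)
Lemma esumZl (c : \bar R) a : 0 <= c -> (forall i, 0 <= a i) ->
  \esum_(i in [set: I]) (c * a i) = c * \esum_(i in [set: I]) a i.
Proof.
have le_Z (d : R) b : (0 <= d)%R -> (forall i, 0 <= b i) ->
    \esum_(i in [set: I]) (d%:E * b i) <= d%:E * \esum_(i in [set: I]) b i.
  move=> d0 b0; apply: ge_ereal_sup => _ [X [finX XI]] <-.
  rewrite -ge0_mule_fsumr//; apply: lee_wpmul2l; first by rewrite lee_fin.
  by apply: esum_ge; exists X.
move=> c0 a0; have [->|cn0] := eqVneq c 0.
  by rewrite mul0e esum1// => i _; rewrite mul0e.
have cp : 0 < c by rewrite lt_def cn0.
case: c c0 cn0 cp => // [c|_ _ _]; rewrite ?lte_fin ?lee_fin.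
  move=> c0 _ cp; apply/eqP; rewrite eq_le le_Z//=.
  rewrite -[leRHS]mul1e -(divff (lt0r_neq0 cp)) EFinM -muleA.
  apply: lee_wpmul2l; first by rewrite lee_fin.
  apply: le_trans (le_Z _ _ _ _); rewrite ?invr_ge0//; last first.
    by move=> i; rewrite mule_ge0.
  by apply: le_esum => i _; rewrite muleA -EFinM mulVf ?lt0r_neq0// mul1e.
have [s0|sn0] := eqVneq (\esum_(i in [set: I]) a i) 0.
  by rewrite s0 mule0 esum1// => i _; rewrite (esum0_eq0 i a0 s0) mule0.
have sp : 0 < \esum_(i in [set: I]) a i by rewrite lt_def sn0 esum_ge0.
rewrite gt0_mulye//; apply/eqP; rewrite -leye_eq.
have [i ai] : exists i, a i != 0.
  apply: contrapT => /forallNP H; move/eqP: sn0; apply.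
  by apply: esum1 => i _; apply/eqP; move/negP: (H i); rewrite negbK.
apply: le_trans (@ge_esum1 (fun i => +oo * a i) i _).
  by rewrite gt0_mulye// lt_def ai a0.
by move=> j; rewrite mule_ge0.
Qed.

Lemma esumZr (c : \bar R) a : 0 <= c -> (forall i, 0 <= a i) ->
  \esum_(i in [set: I]) (a i * c) = (\esum_(i in [set: I]) a i) * c.
Proof.
by move=> c0 a0; rewrite muleC -esumZl//; apply: eq_esum => i _; rewrite muleC.
Qed.

Lemma exchange_esum (J : choiceType) (a : I -> J -> \bar R) :
  (forall i j, 0 <= a i j) ->
  \esum_(i in [set: I]) \esum_(j in [set: J]) a i j =
  \esum_(j in [set: J]) \esum_(i in [set: I]) a i j.
Proof.
move=> a0; rewrite !esum_esum//.
rewrite (@reindex_esum _ _ _ ([set: I] `*`` fun=> [set: J])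
  ([set: J] `*`` fun=> [set: I]) (fun k => (k.2, k.1)))//.
split => //=.
- by move=> [i1 j1] [i2 j2] _ _ /= [-> ->].
- by move=> [j i] _; exists (i, j).
Qed.

Lemma esum_reindex (J : choiceType) (e : I -> J) (a : J -> \bar R) :
  bijective e -> \esum_(j in [set: J]) a j = \esum_(i in [set: I]) a (e i).
Proof.
case=> e' ee' e'e; apply: reindex_esum; split => //.
- by move=> x y _ _; exact: (can_inj ee').
- by move=> y _; exists (e' y).
Qed.

Lemma esum_delta (i : I) a : (forall j, 0 <= a j) ->
  \esum_(j in [set: I]) (if j == i then a j else 0) = a i.
Proof.
move=> a0; rewrite -(@esum_set1 _ _ i a)// [RHS]esum_mkcond.
apply: eq_esum => j _; case: eqVneq => [->|ji]; first by rewrite ifT// inE.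
by rewrite ifF//; apply/negbTE; apply: contra ji; rewrite inE => ->.
Qed.

End NonnegSums.

Section SumShift.
Context {R : realType}.
Local Open Scope ereal_scope.

Lemma esum_nat_recl (a : nat -> \bar R) : (forall n, 0 <= a n) ->
  \esum_(n in [set: nat]) a n = a 0%N + \esum_(n in [set: nat]) a n.+1.
Proof.
move=> a0; rewrite (esumID [set 0%N])// setTI esum_set1//; congr (_ + _).
rewrite setTI; apply: reindex_esum; split => //=.
- by move=> x y _ _ [].
- by move=> [|n] /= H; [case: H | exists n].
Qed.

End SumShift.

Section Hoelder.
Context {R : realType}.

Lemma young_powR (th x y : R) : 0 < th < 1 -> 0 <= x -> 0 <= y ->
  x `^ (1 - th) * y `^ th <= (1 - th) * x + th * y.
Proof.
move=> /andP[t0 t1] x0 y0; have t1' : 0 < 1 - th by rewrite subr_gt0.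
have := @conjugate_powR R (x `^ (1 - th)) (y `^ th) (1 - th)^-1 th^-1.
rewrite !powR_ge0 !invr_gt0 !invrK t0 t1' => /(_ isT isT isT isT).
rewrite -!powRrM !divff ?lt0r_neq0// !powRr1// => H.
by rewrite [X in _ <= X + _]mulrC [X in _ <= _ + X]mulrC; apply: H; rewrite subrK.
Qed.

Context {I : choiceType}.
Local Open Scope ereal_scope.

(** The weights and the exponents [1 - th], [th] are chosen so that Jensen's inequality ([w] of mass
    1, [b] constant 1) and both steps of the interpolation are direct instances. The proof sums
    Young's inequality for the normalised terms, after the cases where a factor on the right is 0 or
    infinite. *)
Lemma hoelder_esum (th : R) (w : I -> R) (a b : I -> \bar R) :
  (0 < th < 1)%R -> (forall i, (0 <= w i)%R) ->
  (forall i, 0 <= a i) -> (forall i, 0 <= b i) ->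
  \esum_(i in [set: I]) ((w i)%:E * (a i `^ (1 - th) * b i `^ th)) <=
  (\esum_(i in [set: I]) ((w i)%:E * a i)) `^ (1 - th) *
  (\esum_(i in [set: I]) ((w i)%:E * b i)) `^ th.
Proof.
move=> /[dup] t01 /andP[t0 t1] w0 a0 b0.
have t1' : (0 < 1 - th)%R by rewrite subr_gt0.
set A := \esum_(i in [set: I]) (_ * a i); set B := \esum_(i in [set: I]) (_ * b i).
have wa0 i : 0 <= (w i)%:E * a i by rewrite mule_ge0// lee_fin.
have wb0 i : 0 <= (w i)%:E * b i by rewrite mule_ge0// lee_fin.
have A0 : 0 <= A by apply: esum_ge0.
have B0 : 0 <= B by apply: esum_ge0.
have [AE|An] := eqVneq A 0.
  rewrite esum1 ?mule_ge0 ?poweR_ge0// => i _.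
  have /eqP := esum0_eq0 i wa0 AE; rewrite mule_eq0 => /orP[/eqP->|/eqP->].
    by rewrite mul0e.
  by rewrite poweR0r ?lt0r_neq0// mul0e mule0.
have [BE|Bn] := eqVneq B 0.
  rewrite esum1 ?mule_ge0 ?poweR_ge0// => i _.
  have /eqP := esum0_eq0 i wb0 BE; rewrite mule_eq0 => /orP[/eqP->|/eqP->].
    by rewrite mul0e.
  by rewrite poweR0r ?lt0r_neq0// !mule0.
have [AE|Ay] := eqVneq A +oo.
  by rewrite AE poweRyr ?lt0r_neq0// gt0_mulye ?leey// poweR_gt0// lt_def Bn.
have [BE|By] := eqVneq B +oo.
  by rewrite BE poweRyr ?lt0r_neq0// gt0_muley ?leey// poweR_gt0// lt_def An.
have Af : A \is a fin_num by rewrite ge0_fin_numE// ltey.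
have Bf : B \is a fin_num by rewrite ge0_fin_numE// ltey.
have wafin i : (w i)%:E * a i \is a fin_num by apply: (esum_lty_fin i wa0); rewrite -/A ltey.
have wbfin i : (w i)%:E * b i \is a fin_num by apply: (esum_lty_fin i wb0); rewrite -/B ltey.
move: An Bn A0 B0; rewrite -(fineK Af) -(fineK Bf).
set x := fine A; set y := fine B; rewrite !eqe !lee_fin => xn yn x0 y0.
have xp : (0 < x)%R by rewrite lt_def xn.
have yp : (0 < y)%R by rewrite lt_def yn.
(* [k] is the right-hand side. Young's inequality for [a i / x] and [b i / y], multiplied by [k] and
   summed with the weights, gives [k * (1 - th) + k * th = k]. *)
pose k := (x `^ (1 - th) * y `^ th)%R.
have k0 : (0 <= k)%R by rewrite mulr_ge0 ?powR_ge0.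
apply: (@le_trans _ _ (\esum_(i in [set: I])
   ((k * (1 - th) / x)%:E * ((w i)%:E * a i) + (k * th / y)%:E * ((w i)%:E * b i)))).
  (* Weight 0 is treated apart because [a i] or [b i] may be infinite there; elsewhere the finite
     sums force finite values. *)
  apply: le_esum => i _; have := w0 i; rewrite le_eqVlt => /predU1P[<-|wp].
    by rewrite !mul0e !mule0 adde0.
  have af : a i \is a fin_num.
    move: (wafin i) (a0 i); case: (a i) => //; by rewrite gt0_muley ?lte_fin.
  have bf : b i \is a fin_num.
    move: (wbfin i) (b0 i); case: (b i) => //; by rewrite gt0_muley ?lte_fin.
  move: (a0 i) (b0 i); rewrite -(fineK af) -(fineK bf) !lee_fin => u0 v0.
  move: (fine (a i)) (fine (b i)) u0 v0 => u v u0 v0.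
  have := @young_powR th (u / x) (v / y) t01 (divr_ge0 u0 x0) (divr_ge0 v0 y0).
  have iv (z r : R) : (0 <= z)%R -> (z^-1 `^ r = (z `^ r)^-1)%R.
    by move=> z0; rewrite -powR_inv1// -powRrM mulN1r powRN.
  rewrite !powRM ?invr_ge0// !iv// => H.
  have xx : (x `^ (1 - th) != 0)%R by rewrite lt0r_neq0// powR_gt0.
  have yy : (y `^ th != 0)%R by rewrite lt0r_neq0// powR_gt0.
  have -> : (u `^ (1 - th) * v `^ th =
    k * (u `^ (1 - th) / x `^ (1 - th) * (v `^ th / y `^ th)))%R.
    by rewrite /k; field; rewrite xx yy.
  have := ler_wpM2l (mulr_ge0 (ltW wp) k0) H.
  rewrite -mulrA => /le_trans; apply.
  by rewrite le_eqVlt; apply/orP; left; apply/eqP; ring.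
have t1W := ltW t1'; have t0W := ltW t0.
have c1 : (0 <= k * (1 - th) / x)%R by exact: divr_ge0 (mulr_ge0 k0 t1W) x0.
have c2 : (0 <= k * th / y)%R by exact: divr_ge0 (mulr_ge0 k0 t0W) y0.
rewrite esumD => [|i _|i _]; try by rewrite mule_ge0// lee_fin.
rewrite !esumZl//; try by rewrite lee_fin.
rewrite -/A -/B -(fineK Af) -(fineK Bf) -!EFinM -EFinD lee_fin -/x -/y -/k.
by rewrite le_eqVlt; apply/orP; left; apply/eqP; field; rewrite xn yn.
Qed.

End Hoelder.

(** * Absolutely convergent real and complex sums *)

Section ComplexModulus.
Context {R : realType}.
Local Notation C := (R[i]).
Local Notation nrm := (@ComplexField.Normc.normc R).
Implicit Types z w : C.

Lemma normc_ge0 z : 0 <= nrm z.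
Proof. by case: z => x y; exact: sqrtr_ge0. Qed.

Lemma ReM z w : complex.Re (z * w) = complex.Re z * complex.Re w - complex.Im z * complex.Im w.
Proof. by case: z; case: w. Qed.

Lemma ImM z w : complex.Im (z * w) = complex.Re z * complex.Im w + complex.Im z * complex.Re w.
Proof. by case: z; case: w. Qed.

Lemma ReD z w : complex.Re (z + w) = complex.Re z + complex.Re w.
Proof. by case: z; case: w. Qed.

Lemma ImD z w : complex.Im (z + w) = complex.Im z + complex.Im w.
Proof. by case: z; case: w. Qed.

Lemma normcD z w : nrm (z + w) <= nrm z + nrm w.
Proof. exact: le_normcD. Qed.

Lemma norm_Re_le z : `|complex.Re z| <= nrm z.
Proof.
by case: z => x y /=; rewrite -sqrtr_sqr; apply: ler_wsqrtr; rewrite lerDl sqr_ge0.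
Qed.

Lemma norm_Im_le z : `|complex.Im z| <= nrm z.
Proof.
by case: z => x y /=; rewrite -sqrtr_sqr; apply: ler_wsqrtr; rewrite lerDr sqr_ge0.
Qed.

Lemma normc_real (x : R) : nrm (x%:C)%C = `|x|.
Proof. by rewrite /= expr0n/= addr0 sqrtr_sqr. Qed.

Lemma eqc z w : complex.Re z = complex.Re w -> complex.Im z = complex.Im w -> z = w.
Proof. by case: z => a b; case: w => c d /= -> ->. Qed.

End ComplexModulus.

Section SignedSums.
Context {R : realType} {I : choiceType}.
Implicit Types u v : I -> R.

(** The body of [rsum] over an arbitrary index type, convertible to [rsum] on a group. Power series
    need the same calculus over [nat]. *)
Definition rsumI u : R :=
  fine (\esum_(s in [set: I]) (Num.max (u s) 0)%:E)
  - fine (\esum_(s in [set: I]) (Num.max (- u s) 0)%:E).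

Definition abs_summable u : Prop := (\esum_(i in [set: I]) `|u i|%:E < +oo)%E.

Lemma fine_esumD u v : (forall i, 0 <= u i) -> (forall i, 0 <= v i) ->
  (\esum_(i in [set: I]) (u i)%:E < +oo)%E ->
  (\esum_(i in [set: I]) (v i)%:E < +oo)%E ->
  fine (\esum_(i in [set: I]) (u i + v i)%:E) =
  fine (\esum_(i in [set: I]) (u i)%:E) + fine (\esum_(i in [set: I]) (v i)%:E).
Proof.
move=> u0 v0 us vs; rewrite -fineD; first last.
- by rewrite ge0_fin_numE// esum_ge0// => i _; rewrite lee_fin.
- by rewrite ge0_fin_numE// esum_ge0// => i _; rewrite lee_fin.
rewrite -esumD; first last.
- by move=> i _; rewrite lee_fin.
- by move=> i _; rewrite lee_fin.
by congr fine; apply: eq_esum => i _; rewrite EFinD.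
Qed.

Lemma summable_le u v : (forall i, u i <= v i) ->
  (\esum_(i in [set: I]) (v i)%:E < +oo)%E ->
  (\esum_(i in [set: I]) (u i)%:E < +oo)%E.
Proof.
by move=> uv; apply: le_lt_trans; apply: le_esum => i _; rewrite lee_fin.
Qed.

Lemma summable_add u v : (forall i, 0 <= u i) -> (forall i, 0 <= v i) ->
  (\esum_(i in [set: I]) (u i)%:E < +oo)%E ->
  (\esum_(i in [set: I]) (v i)%:E < +oo)%E ->
  (\esum_(i in [set: I]) (u i + v i)%:E < +oo)%E.
Proof.
move=> u0 v0 us vs; under eq_esum do rewrite EFinD.
by rewrite esumD ?lte_add_pinfty// => i _; rewrite lee_fin.
Qed.

(** [u] and [v] may overlap, unlike positive and negative parts. Pointwise, the positive part plus
    [v] equals the negative part plus [u]; summing this identity between nonnegative functions gives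
    the claim. Additivity and Fubini rest on it. *)
Lemma rsumIB u v : (forall i, 0 <= u i) -> (forall i, 0 <= v i) ->
  (\esum_(i in [set: I]) (u i)%:E < +oo)%E ->
  (\esum_(i in [set: I]) (v i)%:E < +oo)%E ->
  rsumI (fun i => u i - v i) =
  fine (\esum_(i in [set: I]) (u i)%:E) - fine (\esum_(i in [set: I]) (v i)%:E).
Proof.
move=> u0 v0 us vs; rewrite /rsumI.
set P := fine _; set N := fine (\esum_(s in [set: I]) (Num.max (- _) 0)%:E).
apply/eqP; rewrite subr_eq addrAC eq_sym subr_eq eq_sym; apply/eqP.
have pu i : Num.max (u i - v i) 0 <= u i.
  by rewrite ge_max u0 andbT gerBl.
have nv i : Num.max (- (u i - v i)) 0 <= v i.
  by rewrite ge_max v0 andbT opprB gerBl.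
have p0 i : 0 <= Num.max (u i - v i) 0 by rewrite le_max lexx orbT.
have n0 i : 0 <= Num.max (- (u i - v i)) 0 by rewrite le_max lexx orbT.
have ps := summable_le pu us; have ns := summable_le nv vs.
rewrite /P /N -!fine_esumD//.
congr fine; apply: eq_esum => i _; congr EFin.
by rewrite /Num.max; case: ltP => h1; case: ltP => h2; lra.
Qed.

Lemma rsumI_ge0E u : (forall i, 0 <= u i) ->
  rsumI u = fine (\esum_(i in [set: I]) (u i)%:E).
Proof.
move=> u0; rewrite /rsumI (_ : \esum_(s in _) (Num.max (- _) 0)%:E = 0%E).
  by rewrite subr0; congr fine; apply: eq_esum => i _; rewrite max_l.
by apply: esum1 => i _; rewrite max_r// oppr_le0.
Qed.

Lemma eq_rsumI u v : u =1 v -> rsumI u = rsumI v.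
Proof. by move=> /funext ->. Qed.

Definition posp u i := Num.max (u i) 0.
Definition negp u i := Num.max (- u i) 0.

Lemma posp_ge0 u i : 0 <= posp u i. Proof. by rewrite le_max lexx orbT. Qed.
Lemma negp_ge0 u i : 0 <= negp u i. Proof. by rewrite le_max lexx orbT. Qed.
Lemma pospBnegp u i : u i = posp u i - negp u i.
Proof. by rewrite /posp /negp /Num.max; case: ltP => h1; case: ltP => h2; lra. Qed.
Lemma posp_le u i : posp u i <= `|u i|.
Proof. by rewrite ge_max ler_norm normr_ge0. Qed.
Lemma negp_le u i : negp u i <= `|u i|.
Proof. by rewrite ge_max -normrN ler_norm normr_ge0. Qed.

Lemma rsumID u v : abs_summable u -> abs_summable v ->
  rsumI (fun i => u i + v i) = rsumI u + rsumI v.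
Proof.
move=> us vs.
have pu := summable_le (posp_le u) us; have nu := summable_le (negp_le u) us.
have pv := summable_le (posp_le v) vs; have nv := summable_le (negp_le v) vs.
transitivity (rsumI (fun i => (posp u i + posp v i) - (negp u i + negp v i))).
  by apply: eq_rsumI => i; rewrite {1}(pospBnegp u) {1}(pospBnegp v); ring.
rewrite rsumIB; first last.
- by apply: summable_add => // i; exact: negp_ge0.
- by apply: summable_add => // i; exact: posp_ge0.
- by move=> i; rewrite addr_ge0// negp_ge0.
- by move=> i; rewrite addr_ge0// posp_ge0.
rewrite (fine_esumD (posp_ge0 u) (posp_ge0 v) pu pv).
rewrite (fine_esumD (negp_ge0 u) (negp_ge0 v) nu nv).
by rewrite /rsumI /posp /negp; ring.
Qed.

Lemma rsumIN u : rsumI (fun i => - u i) = - rsumI u.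
Proof. by rewrite /rsumI opprB; congr (_ - fine _); apply: eq_esum => i _; rewrite opprK. Qed.

Lemma rsumIZ (a : R) u : rsumI (fun i => a * u i) = a * rsumI u.
Proof.
wlog a0 : a / 0 <= a.
  move=> H; have [/H//|a0] := leP 0 a.
  rewrite -[RHS]opprK -mulNr -H ?oppr_ge0 ?ltW// -rsumIN.
  by apply: eq_rsumI => i; rewrite mulNr opprK.
rewrite /rsumI mulrBr; congr (_ - _).
  rewrite -[X in X * _]/(fine a%:E).
  under eq_esum do rewrite -[X in Num.max _ X](mulr0 a) -maxr_pMr// EFinM.
  rewrite esumZl; [|by rewrite lee_fin|by move=> i; exact: posp_ge0].
  (* If [E] is infinite, [fine] sends both [E] and its multiple by [a] to 0. *)
  set E := esum _ _; have : (0 <= E)%E by apply: esum_ge0 => i _; exact: posp_ge0.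
  case: E => [r||]//= _; have [->|an] := eqVneq a 0; first by rewrite mul0e mul0r.
  by rewrite gt0_muley ?mulr0// lte_fin lt_def an.
under eq_esum do rewrite -[X in Num.max _ X](mulr0 a) -mulrN -maxr_pMr// EFinM.
rewrite esumZl; [|by rewrite lee_fin|by move=> i; exact: negp_ge0].
set E := esum _ _; have : (0 <= E)%E by apply: esum_ge0 => i _; exact: negp_ge0.
case: E => [r||]//= _; have [->|an] := eqVneq a 0; first by rewrite mul0e mul0r.
by rewrite gt0_muley ?mulr0// lte_fin lt_def an.
Qed.

Lemma norm_rsumI_le u : abs_summable u -> (`|rsumI u|%:E <= \esum_(i in [set: I]) `|u i|%:E)%E.
Proof.
move=> us; have pu := summable_le (posp_le u) us; have nu := summable_le (negp_le u) us.
have pf : (\esum_(i in [set: I]) (posp u i)%:E)%E \is a fin_num.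
  by rewrite ge0_fin_numE// esum_ge0// => i _; exact: posp_ge0.
have nf : (\esum_(i in [set: I]) (negp u i)%:E)%E \is a fin_num.
  by rewrite ge0_fin_numE// esum_ge0// => i _; exact: negp_ge0.
have -> : (\esum_(i in [set: I]) `|u i|%:E =
   \esum_(i in [set: I]) (posp u i)%:E + \esum_(i in [set: I]) (negp u i)%:E)%E.
  rewrite -esumD; [|by move=> i _; exact: posp_ge0|by move=> i _; exact: negp_ge0].
  apply: eq_esum => i _; rewrite -EFinD; congr EFin.
  rewrite /posp /negp; case/orP: (le_total 0 (u i)) => u0.
    by rewrite max_l// max_r ?oppr_le0// addr0 ger0_norm.
  by rewrite max_r// max_l ?oppr_ge0// add0r ler0_norm.
rewrite -(fineK pf) -(fineK nf) lee_fin.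
apply: le_trans (ler_normB _ _) _; rewrite !ger0_norm// fine_ge0// esum_ge0// => i _;
  by rewrite lee_fin ?posp_ge0 ?negp_ge0.
Qed.

Lemma abs_summable_le u (v : I -> R) : (forall i, `|u i| <= v i) ->
  (\esum_(i in [set: I]) (v i)%:E < +oo)%E -> abs_summable u.
Proof. exact: summable_le. Qed.

End SignedSums.

Section Fubini.
Context {R : realType} {I J : choiceType}.

(** Each inner sum is a difference [P i - N i], which is in general not its splitting into positive
    and negative part; [rsumIB] accepts it nevertheless. Tonelli then applies to each of the two
    double sums. *)
Let rsumI2 (K L : choiceType) (F : K -> L -> R) :
  (\esum_(i in [set: K]) \esum_(j in [set: L]) `|F i j|%:E < +oo)%E ->
  rsumI (fun i => rsumI (F i)) =
  fine (\esum_(i in [set: K]) \esum_(j in [set: L]) (posp (F i) j)%:E)%E -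
  fine (\esum_(i in [set: K]) \esum_(j in [set: L]) (negp (F i) j)%:E)%E.
Proof.
move=> s; have s0 i : (0 <= \esum_(j in [set: L]) `|F i j|%:E)%E by rewrite esum_ge0.
have P0 i : (0 <= \esum_(j in [set: L]) (posp (F i) j)%:E)%E.
  by rewrite esum_ge0// => j _; exact: posp_ge0.
have N0 i : (0 <= \esum_(j in [set: L]) (negp (F i) j)%:E)%E.
  by rewrite esum_ge0// => j _; exact: negp_ge0.
have si i : abs_summable (F i).
  by have := esum_lty_fin i s0 s; rewrite ge0_fin_numE.
have pf i : (\esum_(j in [set: L]) (posp (F i) j)%:E)%E \is a fin_num.
  by rewrite ge0_fin_numE ?P0//; exact: (summable_le (posp_le (F i)) (si i)).
have nf i : (\esum_(j in [set: L]) (negp (F i) j)%:E)%E \is a fin_num.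
  by rewrite ge0_fin_numE ?N0//; exact: (summable_le (negp_le (F i)) (si i)).
pose P i := fine (\esum_(j in [set: L]) (posp (F i) j)%:E)%E.
pose N i := fine (\esum_(j in [set: L]) (negp (F i) j)%:E)%E.
rewrite -[LHS]/(rsumI (fun i => P i - N i)) rsumIB /P /N.
- by congr (fine _ - fine _); apply: eq_esum => i _; rewrite fineK.
- by move=> i; rewrite fine_ge0.
- by move=> i; rewrite fine_ge0.
- apply: le_lt_trans s; apply: le_esum => i _; rewrite fineK//.
  by apply: le_esum => j _; rewrite lee_fin posp_le.
- apply: le_lt_trans s; apply: le_esum => i _; rewrite fineK//.
  by apply: le_esum => j _; rewrite lee_fin negp_le.
Qed.

Lemma rsumI_fubini (F : I -> J -> R) :
  (\esum_(i in [set: I]) \esum_(j in [set: J]) `|F i j|%:E < +oo)%E ->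
  rsumI (fun i => rsumI (F i)) = rsumI (fun j => rsumI (F^~ j)).
Proof.
move=> s; rewrite !rsumI2//; last by rewrite exchange_esum.
congr (fine _ - fine _); apply: exchange_esum => i j.
  exact: posp_ge0.
exact: negp_ge0.
Qed.

End Fubini.

Section ComplexSums.
Context {R : realType} {I : choiceType}.
Local Notation C := (R[i]).
Local Notation nrm := (@ComplexField.Normc.normc R).
Implicit Types f g : I -> C.

Definition csumI f : C :=
  Complex (rsumI (fun i => complex.Re (f i))) (rsumI (fun i => complex.Im (f i))).

Definition cabs_summable f : Prop := (\esum_(i in [set: I]) (nrm (f i))%:E < +oo)%E.

Lemma eq_csumI f g : f =1 g -> csumI f = csumI g.
Proof. by move=> /funext ->. Qed.

Lemma cabs_summable_Re f : cabs_summable f -> abs_summable (fun i => complex.Re (f i)).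
Proof. by apply: abs_summable_le => i; exact: norm_Re_le. Qed.

Lemma cabs_summable_Im f : cabs_summable f -> abs_summable (fun i => complex.Im (f i)).
Proof. by apply: abs_summable_le => i; exact: norm_Im_le. Qed.

Lemma csumID f g : cabs_summable f -> cabs_summable g ->
  csumI (fun i => f i + g i) = csumI f + csumI g.
Proof.
move=> fs gs; apply: eqc => /=.
  rewrite -rsumID; [|exact: cabs_summable_Re..].
  by apply: eq_rsumI => i; exact: ReD.
rewrite -rsumID; [|exact: cabs_summable_Im..].
by apply: eq_rsumI => i; exact: ImD.
Qed.

Lemma abs_summableZ (a : R) (u : I -> R) : abs_summable u -> abs_summable (fun i => a * u i).
Proof.
move=> us; rewrite /abs_summable; under eq_esum do rewrite normrM EFinM.
by rewrite esumZl//; apply: lte_mul_pinfty.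
Qed.

Lemma csumIZ (a : C) f : cabs_summable f -> csumI (fun i => a * f i) = a * csumI f.
Proof.
move=> fs; have rs := cabs_summable_Re fs; have ims := cabs_summable_Im fs.
apply: eqc; rewrite ?ReM ?ImM /= -!rsumIZ.
  rewrite -rsumIN -rsumID; [|exact: abs_summableZ|].
    by apply: eq_rsumI => i; exact: ReM.
  by rewrite /abs_summable; under eq_esum do rewrite normrN; exact: abs_summableZ.
rewrite -rsumID; [|exact: abs_summableZ..].
by apply: eq_rsumI => i; exact: ImM.
Qed.

Lemma cabs_summableZ (a : C) f : cabs_summable f -> cabs_summable (fun i => a * f i).
Proof.
move=> fs; rewrite /cabs_summable; under eq_esum do rewrite ComplexField.Normc.normcM EFinM.
rewrite esumZl; [|by rewrite lee_fin normc_ge0|by move=> i; rewrite lee_fin normc_ge0].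
by apply: lte_mul_pinfty; rewrite // lee_fin normc_ge0.
Qed.

Lemma cabs_summableD f g : cabs_summable f -> cabs_summable g ->
  cabs_summable (fun i => f i + g i).
Proof.
move=> fs gs; apply: (@summable_le _ _ _ (fun i => nrm (f i) + nrm (g i))).
  by move=> i; exact: normcD.
by apply: summable_add => // i; exact: normc_ge0.
Qed.

Lemma csumI_lin (a : C) f g : cabs_summable f -> cabs_summable g ->
  csumI (fun i => a * f i + g i) = a * csumI f + csumI g.
Proof. by move=> fs gs; rewrite csumID ?csumIZ//; exact: cabs_summableZ. Qed.

(* Testing against the conjugate of the sum itself gives the constant 1. *)
Lemma normc_csumI_le f : cabs_summable f ->
  ((nrm (csumI f))%:E <= \esum_(i in [set: I]) (nrm (f i))%:E)%E.
Proof.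
move=> fs; set z := csumI f; set S := esum _ _.
have S0 : (0 <= S)%E by apply: esum_ge0 => i _; rewrite lee_fin normc_ge0.
have [->|zn] := eqVneq (nrm z) 0; first exact: S0.
have zp : 0 < nrm z by rewrite lt_def zn normc_ge0.
pose w : C := Complex (complex.Re z) (- complex.Im z).
have nw : nrm w = nrm z by rewrite /w; case: (z) => a b /=; rewrite sqrrN.
have wz : complex.Re (w * z) = nrm z ^+ 2.
  rewrite /w; case: (z) => a b; rewrite ReM /= sqr_sqrtr ?addr_ge0 ?sqr_ge0//.
  by ring.
have := norm_rsumI_le (cabs_summable_Re (cabs_summableZ w fs)).
have -> : rsumI (fun i => complex.Re (w * f i)) = nrm z ^+ 2.
  by rewrite -wz -(csumIZ w fs).
rewrite ger0_norm ?sqr_ge0// => H.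
have : ((nrm z ^+ 2)%:E <= (nrm z)%:E * S)%E.
  apply: le_trans H _; rewrite -esumZl; first last.
  - by move=> i; rewrite lee_fin normc_ge0.
  - by rewrite lee_fin normc_ge0.
  apply: le_esum => i _; rewrite -EFinM lee_fin -nw -ComplexField.Normc.normcM.
  exact: norm_Re_le.
move: S0; case: (S) => [r||]//= S0; rewrite ?leey// -EFinM !lee_fin expr2.
by rewrite ler_pM2l.
Qed.

End ComplexSums.

Lemma csumI_fubini {R : realType} {I J : choiceType} (F : I -> J -> R[i]) :
  (\esum_(i in [set: I]) \esum_(j in [set: J])
     (ComplexField.Normc.normc (F i j))%:E < +oo)%E ->
  csumI (fun i => csumI (F i)) = csumI (fun j => csumI (F^~ j)).
Proof.
move=> s; apply: eqc => /=; apply: rsumI_fubini.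
  apply: le_lt_trans s; apply: le_esum => i _; apply: le_esum => j _.
  by rewrite lee_fin norm_Re_le.
apply: le_lt_trans s; apply: le_esum => i _; apply: le_esum => j _.
by rewrite lee_fin norm_Im_le.
Qed.

(** * Convolution of nonnegative functions *)

Section Group.
Variable G : cgroup.
Implicit Types x y t : G.

Lemma gmulKV t x : gmul (ginv t) (gmul t x) = x.
Proof. by rewrite gmulA gmulV gmul1. Qed.

(** The group axioms are one-sided. A left inverse of [ginv x], inserted on the left, turns the left
    inverse into a right one. *)
Lemma gmulVr x : gmul x (ginv x) = gone G.
Proof.
rewrite -[LHS]gmul1 -{1}(gmulV (ginv x)) -gmulA [gmul (ginv x) _]gmulA.
by rewrite gmulV gmul1 gmulV.
Qed.

Lemma gmulVK t x : gmul t (gmul (ginv t) x) = x.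
Proof. by rewrite gmulA gmulVr gmul1. Qed.

Lemma gmulr1 x : gmul x (gone G) = x.
Proof. by rewrite -(gmulV x) gmulVK. Qed.

Lemma ginvM x y : ginv (gmul x y) = gmul (ginv y) (ginv x).
Proof.
have e : gmul (gmul x y) (gmul (ginv y) (ginv x)) = gone G.
  by rewrite -gmulA gmulVK gmulVr.
by rewrite -[LHS]gmulr1 -e gmulKV.
Qed.

Lemma ginv1 : ginv (gone G) = gone G.
Proof. by rewrite -[LHS]gmulr1 gmulV. Qed.

Lemma gmul_bij t : bijective (gmul t).
Proof. by exists (gmul (ginv t)) => x; [exact: gmulKV|exact: gmulVK]. Qed.

Lemma gmulV_bij t : bijective (gmul (ginv t)).
Proof. by exists (gmul t) => x; [exact: gmulVK|exact: gmulKV]. Qed.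

End Group.

Section Convolution.
Context {R : realType} {G : cgroup}.
Local Open Scope ereal_scope.
Implicit Types (K mu nu : G -> R) (f g : G -> \bar R).

(** Convolution without convergence conditions: the value [+oo] is allowed, and finiteness is
    recovered afterwards from the q-mass. *)
Definition econv K f (s : G) : \bar R :=
  \esum_(t in [set: G]) ((K t)%:E * f (gmul (ginv t) s)).

Definition nneg K := forall s, (0 <= K s)%R.

Lemma econv_term_ge0 K f s t : nneg K -> (forall s, 0 <= f s) ->
  0 <= (K t)%:E * f (gmul (ginv t) s).
Proof. by move=> K0 f0; rewrite mule_ge0// lee_fin. Qed.

Lemma econv_ge0 K f s : nneg K -> (forall s, 0 <= f s) -> 0 <= econv K f s.
Proof. by move=> K0 f0; apply: esum_ge0 => t _; exact: econv_term_ge0. Qed.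

Lemma le_econv K f g s : nneg K -> (forall s, f s <= g s) -> econv K f s <= econv K g s.
Proof.
by move=> K0 fg; apply: le_esum => t _; apply: lee_wpmul2l => //; rewrite lee_fin.
Qed.

Lemma econvZ K (c : \bar R) f s : nneg K -> 0 <= c -> (forall s, 0 <= f s) ->
  econv K (fun s => c * f s) s = c * econv K f s.
Proof.
move=> K0 c0 f0; rewrite /econv -esumZl//; last by move=> t; exact: econv_term_ge0.
by apply: eq_esum => t _; rewrite muleCA.
Qed.

Lemma econvD K f g s : nneg K -> (forall s, 0 <= f s) -> (forall s, 0 <= g s) ->
  econv K (fun s => f s + g s) s = econv K f s + econv K g s.
Proof.
move=> K0 f0 g0; rewrite /econv -esumD; first last.
- by move=> t _; exact: econv_term_ge0.
- by move=> t _; exact: econv_term_ge0.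
by apply: eq_esum => t _; rewrite ge0_muleDr.
Qed.

(** Tonelli, after which left translation by [t] leaves the sum of [f] unchanged. *)
Lemma esum_econv K f : nneg K -> (forall s, 0 <= f s) ->
  \esum_(s in [set: G]) econv K f s =
  (\esum_(s in [set: G]) (K s)%:E) * \esum_(s in [set: G]) f s.
Proof.
move=> K0 f0; rewrite /econv exchange_esum; last first.
  by move=> s t; exact: econv_term_ge0.
rewrite -esumZr; [|by apply: esum_ge0|by move=> i; rewrite lee_fin].
apply: eq_esum => t _; rewrite esumZl ?lee_fin//.
by rewrite [in RHS](esum_reindex _ (gmulV_bij t)).
Qed.

Lemma econv_delta f s : (forall s, 0 <= f s) -> econv (@delta_e R G) f s = f s.
Proof.
move=> f0; rewrite /econv.
have := @esum_delta R G (gone G) (fun t => f (gmul (ginv t) s)) (fun t => f0 _).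
rewrite ginv1 gmul1 => <-; apply: eq_esum => t _; rewrite /delta_e.
by case: eqP; rewrite ?mul1e ?mul0e.
Qed.

Lemma prob_nneg mu : prob_measure mu -> nneg mu. Proof. by case. Qed.

Lemma prob_le1 mu s : prob_measure mu -> (mu s <= 1)%R.
Proof.
by case=> m0 m1; rewrite -lee_fin -m1; apply: (@ge_esum1 _ _ (fun s => (mu s)%:E)).
Qed.

Lemma rconvE mu nu s : prob_measure mu -> prob_measure nu ->
  (rconv mu nu s)%:E = econv mu (EFin \o nu) s.
Proof.
move=> m n; have m0 := prob_nneg m; have n0 := prob_nneg n.
have -> : rconv mu nu s = rsumI (fun t => mu t * nu (gmul (ginv t) s))%R by [].
rewrite rsumI_ge0E; last by move=> t; rewrite mulr_ge0.
rewrite fineK; first by apply: eq_esum => t _; rewrite EFinM.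
rewrite ge0_fin_numE ?esum_ge0//; last by move=> t _; rewrite lee_fin mulr_ge0.
apply: le_lt_trans (ltry 1); rewrite -m.2; apply: le_esum => t _.
by rewrite lee_fin ler_piMr// prob_le1.
Qed.

Lemma rconv_prob mu nu : prob_measure mu -> prob_measure nu -> prob_measure (rconv mu nu).
Proof.
move=> m n; have m0 := prob_nneg m; have n0 := prob_nneg n; split.
  by move=> s; rewrite -lee_fin rconvE// econv_ge0// => t; rewrite lee_fin.
under eq_esum do rewrite rconvE//.
by rewrite esum_econv// m.2 n.2 mule1.
Qed.

Lemma econv_rconv mu nu f s : prob_measure mu -> prob_measure nu -> (forall s, 0 <= f s) ->
  econv (rconv mu nu) f s = econv mu (econv nu f) s.
Proof.
move=> m n f0; have m0 := prob_nneg m; have n0 := prob_nneg n.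
transitivity (\esum_(x in [set: G]) \esum_(t in [set: G])
  ((mu t)%:E * (nu (gmul (ginv t) x))%:E * f (gmul (ginv x) s))).
  apply: eq_esum => x _; rewrite rconvE// /econv esumZr// => t.
  by rewrite mule_ge0// lee_fin.
rewrite exchange_esum; last by move=> x t; rewrite !mule_ge0// lee_fin.
apply: eq_esum => t _; rewrite -esumZl ?lee_fin//; last by move=> u; exact: econv_term_ge0.
(* Substitution [x = t u]. *)
rewrite (esum_reindex _ (gmul_bij t)); apply: eq_esum => u _ /=.
by rewrite gmulKV ginvM -gmulA muleA.
Qed.

Lemma delta_prob : prob_measure (@delta_e R G).
Proof.
split; first by move=> s; rewrite /delta_e; case: ifP.
rewrite -[RHS](@esum_delta R G (gone G) (fun=> 1))//.
by apply: eq_esum => t _; rewrite /delta_e; case: ifP.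
Qed.

Lemma convpow_prob mu n : prob_measure mu -> prob_measure (convpow mu n).
Proof. by move=> m; elim: n => [|n IH]; [exact: delta_prob|exact: rconv_prob]. Qed.

Lemma econv_convpowS mu n f s : prob_measure mu -> (forall s, 0 <= f s) ->
  econv (convpow mu n.+1) f s = econv mu (econv (convpow mu n) f) s.
Proof. by move=> m f0; rewrite econv_rconv//; exact: convpow_prob. Qed.

Lemma econv_convpowD mu m n f : prob_measure mu -> (forall s, 0 <= f s) ->
  econv (convpow mu (m + n)) f = econv (convpow mu m) (econv (convpow mu n) f).
Proof.
move=> p f0; have e0 k s : 0 <= econv (convpow mu k) f s.
  by apply: econv_ge0 => //; exact/prob_nneg/convpow_prob.
elim: m => [|m IH]; apply/funext => s; first by rewrite econv_delta.
by rewrite addSn !econv_convpowS// IH.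
Qed.

Lemma convpowD mu m n : prob_measure mu ->
  convpow mu (m + n) = rconv (convpow mu m) (convpow mu n).
Proof.
move=> p; have P k := convpow_prob k p.
have n0 : forall s : G, 0 <= (EFin \o convpow mu n) s.
  by move=> s; rewrite lee_fin; exact: prob_nneg.
elim: m => [|m IH]; apply/funext => s; apply: EFin_inj.
  by rewrite rconvE ?econv_delta//; exact: delta_prob.
rewrite addSn rconvE// econv_convpowS// -[LHS]/((rconv mu (convpow mu (m + n)) s)%:E).
rewrite rconvE//; congr (econv mu _ s); apply/funext => t.
by rewrite -rconvE//= IH.
Qed.

End Convolution.

Section QNorm.
Context {R : realType} {G : cgroup}.
Variable q : R.
Hypothesis q1 : (1 < q)%R.
Local Open Scope ereal_scope.
Implicit Types (K mu nu : G -> R) (f g : G -> \bar R).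

Let q0 : (0 < q)%R. Proof. exact: lt_trans q1. Qed.
Let qn0 : q != 0%R. Proof. exact: lt0r_neq0. Qed.

(* The q-th power of the l^q norm. *)
Definition qmass f : \bar R := \esum_(s in [set: G]) (f s `^ q).

Lemma qmass_ge0 f : 0 <= qmass f.
Proof. by apply: esum_ge0 => s _; exact: poweR_ge0. Qed.

Lemma le_poweR (x y : \bar R) (r : R) : (0 <= r)%R -> 0 <= x -> x <= y -> x `^ r <= y `^ r.
Proof.
move=> r0 x0 xy; apply: gt0_ler_poweR => //; rewrite in_itv/= leey andbT//.
exact: le_trans xy.
Qed.

Lemma le_qmass f g : (forall s, 0 <= f s) -> (forall s, f s <= g s) -> qmass f <= qmass g.
Proof. by move=> f0 fg; apply: le_esum => s _; apply: le_poweR => //; exact: ltW. Qed.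

Lemma qmassZ (c : \bar R) f : 0 <= c -> (forall s, 0 <= f s) ->
  qmass (fun s => c * f s) = c `^ q * qmass f.
Proof.
move=> c0 f0; rewrite /qmass -esumZl ?poweR_ge0//; last by move=> s; exact: poweR_ge0.
by apply: eq_esum => s _; rewrite poweRM.
Qed.

Lemma qmass_fin f s : (forall s, 0 <= f s) -> qmass f < +oo -> f s < +oo.
Proof.
move=> f0 /(esum_lty_fin s (fun s => poweR_ge0 _ _)).
by rewrite ge0_fin_numE ?poweR_ge0// => /lty_poweRy; apply.
Qed.

Lemma qmass0 : qmass (fun=> 0) = 0.
Proof. by rewrite /qmass esum1// => s _; rewrite poweR0r. Qed.

Lemma qmass_eq0 f s : (forall s, 0 <= f s) -> qmass f = 0 -> f s = 0.
Proof.
by move=> f0 /(esum0_eq0 s (fun s => poweR_ge0 _ _)) /poweR_eq0_eq0; apply.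
Qed.

(* Jensen's inequality for [x `^ q]. *)
Lemma qmass_econv_prob nu f : prob_measure nu -> (forall s, 0 <= f s) ->
  qmass (econv nu f) <= qmass f.
Proof.
move=> n f0; have n0 := prob_nneg n.
have -> : qmass f = \esum_(s in [set: G]) econv nu (fun s => f s `^ q) s.
  by rewrite esum_econv// ?n.2 ?mul1e// => s; exact: poweR_ge0.
apply: le_esum => s _; rewrite /econv.
(* With [th = 1 - 1/q] the function [f^q] enters Hoelder with exponent [1/q], and the constant 1
   takes the rest. *)
have t01 : (0 < 1 - q^-1 < 1)%R.
  by rewrite subr_gt0 invf_lt1// q1 gtrBl invr_gt0.
have := @hoelder_esum R G (1 - q^-1) nu (fun t => f (gmul (ginv t) s) `^ q) (fun=> 1) t01 n0
   (fun t => poweR_ge0 _ _) (fun=> lee01).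
under eq_esum do rewrite poweR1r mule1 opprB addrCA subrr addr0 -poweRrM divff// poweRe1//.
under [X in _ <= _ * X `^ _ -> _]eq_esum do rewrite mule1.
rewrite n.2 poweR1r mule1 opprB addrCA subrr addr0 => H.
apply: le_trans (le_poweR (ltW q0) _ H) _; first by apply: econv_ge0.
rewrite -poweRrM mulVf// poweRe1// esum_ge0// => t _.
by rewrite mule_ge0 ?poweR_ge0// lee_fin.
Qed.

Definition opq K : \bar R := ereal_sup
  [set qmass (econv K f) | f in [set f | (forall s, 0 <= f s) /\ qmass f <= 1]].

Lemma opq_ge0 K : nneg K -> 0 <= opq K.
Proof.
move=> K0; apply: le_trans (qmass_ge0 (econv K (fun=> 0))) _.
by apply: ereal_sup_ubound; exists (fun=> 0) => //; split => //; rewrite qmass0.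
Qed.

Lemma opq_bound K f : nneg K -> (forall s, 0 <= f s) -> qmass f < +oo ->
  qmass (econv K f) <= opq K * qmass f.
Proof.
move=> K0 f0 fq; have [e0|en] := eqVneq (qmass f) 0.
  rewrite e0 mule0 (_ : econv K f = fun=> 0) ?qmass0//.
  apply/funext => s; apply: esum1 => t _.
  by rewrite (qmass_eq0 _ f0 e0) mule0.
have ef : qmass f \is a fin_num by rewrite ge0_fin_numE// qmass_ge0.
have : 0 < qmass f by rewrite lt_def en qmass_ge0.
rewrite -(fineK ef); set e := fine _; rewrite lte_fin => ep.
(* [c^q = 1/e], so [c f] has q-mass 1 and is an admissible test function. *)
pose c := (e^-1 `^ q^-1)%R; have c0 : 0 <= c%:E by rewrite lee_fin powR_ge0.
have cq : c%:E `^ q = e^-1%:E.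
  by rewrite poweR_EFin -powRrM mulVf// powRr1// invr_ge0 ltW.
have : qmass (econv K (fun s => c%:E * f s)) <= opq K.
  apply: ereal_sup_ubound; exists (fun s => c%:E * f s) => //; split.
    by move=> s; rewrite mule_ge0.
  by rewrite qmassZ// cq -(fineK ef) -/e -EFinM mulVf ?lt0r_neq0.
rewrite (_ : econv K (fun s => _) = fun s => c%:E * econv K f s); last first.
  by apply/funext => s; rewrite econvZ.
rewrite qmassZ ?cq//; last by move=> s; exact: econv_ge0.
move=> /(lee_wpmul2r (_ : 0 <= e%:E)); rewrite lee_fin => /(_ (ltW ep)).
by rewrite muleC muleA -EFinM divff ?mul1e ?lt0r_neq0.
Qed.

Lemma opq_le K (c : \bar R) : 0 <= c ->
  (forall f, (forall s, 0 <= f s) -> qmass f < +oo -> qmass (econv K f) <= c * qmass f) ->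
  opq K <= c.
Proof.
move=> c0 H; apply: ge_ereal_sup => _ [f [f0 f1] <-].
apply: le_trans (H f f0 (le_lt_trans f1 (ltry 1))) _.
by rewrite -[leRHS]mule1 lee_wpmul2l.
Qed.

Lemma opq_prob_le1 nu : prob_measure nu -> opq nu <= 1.
Proof. by move=> n; apply: opq_le => // f f0 _; rewrite mul1e qmass_econv_prob. Qed.

Lemma opq_fin nu : prob_measure nu -> opq nu \is a fin_num.
Proof.
move=> n; rewrite ge0_fin_numE; last exact/opq_ge0/prob_nneg.
exact: le_lt_trans (opq_prob_le1 n) (ltry 1).
Qed.

(** The test function is [delta_e]: it has q-mass 1, and convolution by [nu] sends it to [nu]. *)
Lemma opq_ge_qmass nu : prob_measure nu -> qmass (EFin \o nu) <= opq nu.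
Proof.
move=> n; have n0 := prob_nneg n.
pose f := EFin \o @delta_e R G.
have f0 s : 0 <= f s by rewrite lee_fin /delta_e; case: ifP.
have fq : qmass f = 1.
  rewrite -[RHS](@esum_delta R G (gone G) (fun=> 1))//.
  apply: eq_esum => t _; rewrite /f /= /delta_e; case: ifP => _; first by rewrite powR1.
  by rewrite powR0.
have := opq_bound n0 f0; rewrite fq mule1 => /(_ (ltry 1)).
rewrite (_ : econv nu f = EFin \o nu)//; apply/funext => s /=.
rewrite /econv -[RHS](esum_delta s (fun t => (_ : 0 <= (EFin \o nu) t)))//.
apply: eq_esum => t _; rewrite /f /= /delta_e.
have -> : (gmul (ginv t) s == gone G) = (t == s).
  apply/eqP/eqP => [h|->]; last exact: gmulV.
  by rewrite -(gmulr1 t) -h gmulVK.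
by case: ifP; rewrite ?mule1 ?mule0.
Qed.

End QNorm.

(** * Interpolation, entropy and subadditive sequences *)

Section Interpolation.
Context {R : realType} {G : cgroup}.
Local Open Scope ereal_scope.

(* Riesz-Thorin between l^1 and l^{q1}; for a positive kernel it only needs Hoelder. *)
Lemma opq_interpolation (q1 q2 th : R) (nu : G -> R) :
  (1 < q1)%R -> (1 < q2)%R -> (0 < th < 1)%R -> (q2^-1 = 1 - th + th / q1)%R ->
  prob_measure nu -> opq q2 nu <= opq q1 nu `^ (th * q2 / q1).
Proof.
move=> q11 q21 t01 e n; have n0 := prob_nneg n.
have q1p : (0 < q1)%R by exact: lt_trans q11.
have q2p : (0 < q2)%R by exact: lt_trans q21.
have q1n := lt0r_neq0 q1p; have q2n := lt0r_neq0 q2p.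
have /andP[t0 t1] := t01.
have e' : (q2 * (1 - th) + th * q2 / q1 = 1)%R.
  by rewrite -[RHS](divff q2n) e; field.
pose tau := (th * q2 / q1)%R.
have tau0 : (0 < tau)%R by rewrite divr_gt0// mulr_gt0.
have tau1 : (tau < 1)%R.
  have : (0 < q2 * (1 - th))%R by rewrite mulr_gt0// subr_gt0.
  by move: e'; rewrite -/tau; lra.
have tauE : (q2 * (1 - th) = 1 - tau)%R by move: e'; rewrite -/tau; lra.
apply: opq_le => [|f f0 fq]; first exact: poweR_ge0.
(* [a] is measured in l^1 and [b] in l^q1; both masses equal the q2-mass of [f], and
   [f = a^(1-th) b^th] by the relation between the exponents. *)
pose a s := f s `^ q2; pose b s := f s `^ (q2 / q1).
have a0 s : 0 <= a s by exact: poweR_ge0.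
have b0 s : 0 <= b s by exact: poweR_ge0.
have fab s : f s = a s `^ (1 - th) * b s `^ th.
  have eth : (q2 * (1 - th) + q2 / q1 * th = 1)%R by rewrite -[RHS]e'; field.
  rewrite -!poweRrM -poweRD ?eth ?poweRe1//.
  by rewrite poweRD_defE eth oner_eq0.
have qb : qmass q1 b = qmass q2 f.
  by apply: eq_esum => s _; rewrite /b -poweRrM divfK.
have step s : econv nu f s <= econv nu a s `^ (1 - th) * econv nu b s `^ th.
  rewrite {1}/econv; under eq_esum do rewrite fab.
  exact: hoelder_esum.
have ea0 s : 0 <= econv nu a s by exact: econv_ge0.
have eb0 s : 0 <= econv nu b s by exact: econv_ge0.
(* [step] was Hoelder in the convolution variable. Raised to the power [q2], it has exponents
   [1 - tau] and [tau], which prepares a second Hoelder inequality, in [s] with unit weights. *)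
apply: (@le_trans _ _ (\esum_(s in [set: G])
   (1%:E * (econv nu a s `^ (1 - tau) * (econv nu b s `^ q1) `^ tau)))).
  apply: le_esum => s _; rewrite mul1e.
  apply: le_trans (le_poweR (ltW q2p) _ (step s)) _; first exact: econv_ge0.
  rewrite poweRM ?poweR_ge0// -!poweRrM (mulrC (1 - th)%R) tauE.
  by rewrite (_ : th * q2 = q1 * tau)%R// /tau; field.
apply: le_trans.
  by apply: (@hoelder_esum R G tau (fun=> 1%R)) => //; [rewrite tau0|move=> s; exact: poweR_ge0].
under eq_esum do rewrite mul1e.
under [X in _ * X `^ _ <= _]eq_esum do rewrite mul1e.
rewrite esum_econv// n.2 mul1e -[esum _ a]/(qmass q2 f).
rewrite -[X in _ * X `^ _]/(qmass q1 (econv nu b)).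
have H : qmass q1 (econv nu b) <= opq q1 nu * qmass q2 f.
  by rewrite -qb; apply: opq_bound => //; rewrite qb.
have := le_poweR (ltW tau0) (qmass_ge0 _ _) H.
rewrite poweRM ?qmass_ge0 ?opq_ge0// => H2.
apply: le_trans (lee_wpmul2l (poweR_ge0 _ _) H2) _.
(* The powers [1 - tau] and [tau] of the q2-mass of [f] recombine to the first power. *)
rewrite muleCA -poweRD; last by rewrite poweRD_defE subrK oner_eq0.
by rewrite subrK poweRe1// qmass_ge0.
Qed.

End Interpolation.

Section Entropy.
Context {R : realType} {G : cgroup}.
Local Open Scope ereal_scope.
Implicit Types mu nu : G -> R.

Lemma entropy_term_ge0 mu s : prob_measure mu -> (0 <= - (mu s * ln (mu s)))%R.
Proof.
move=> m; rewrite -mulrN mulr_ge0//; first exact: prob_nneg.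
by rewrite oppr_ge0 ln_le0// prob_le1.
Qed.

Lemma shannon_esum_ge0 mu : prob_measure mu -> 0 <= shannon_esum mu.
Proof. by move=> m; apply: esum_ge0 => s _; rewrite lee_fin entropy_term_ge0. Qed.

Lemma shannonK mu : prob_measure mu -> finite_entropy mu -> (shannon mu)%:E = shannon_esum mu.
Proof. by move=> m h; rewrite fineK// ge0_fin_numE// shannon_esum_ge0. Qed.

Lemma shannon_ge0 mu : prob_measure mu -> (0 <= shannon mu)%R.
Proof. by move=> m; rewrite fine_ge0// shannon_esum_ge0. Qed.

(** Jensen's inequality for the exponential: [mu^q = mu * exp ((q - 1) ln mu)], and the [mu]-mean of
    [(q - 1) ln mu] is [- c]. The proof integrates the tangent line at that mean. *)
Lemma qmass_ge_entropy (q : R) mu : (1 < q)%R -> prob_measure mu -> finite_entropy mu ->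
  (expR (- ((q - 1) * shannon mu)))%:E <= qmass q (EFin \o mu).
Proof.
move=> q1 m h; have m0 := prob_nneg m; set c := ((q - 1) * shannon mu)%R.
have q0 : (0 < q)%R by exact: lt_trans q1.
have qB : (0 <= q - 1)%R by rewrite subr_ge0 ltW.
(* The tangent to [expR] at [- c], with the logarithmic term moved to the right so that both sides
   are nonnegative and can be summed in [\bar R]. *)
have term s : (mu s * (expR (- c) * (1 + c)) <=
    mu s `^ q + expR (- c) * (q - 1) * - (mu s * ln (mu s)))%R.
  have := m0 s; rewrite le_eqVlt => /predU1P[<-|mp].
    by rewrite !mul0r oppr0 mulr0 addr0 powR_ge0.
  have -> : (mu s `^ q = mu s * (expR (- c) * expR (c + (q - 1) * ln (mu s))))%R.
    by rewrite -expRD addKr -mulr_powRB1// /powR gt_eqF.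
  have := expR_ge1Dx (c + (q - 1) * ln (mu s)).
  move/(ler_wpM2l (mulr_ge0 (m0 s) (expR_ge0 (- c)))) => H.
  rewrite -lerBlDr [leRHS]mulrA; apply: le_trans H.
  rewrite le_eqVlt; apply/orP; left; apply/eqP; ring.
have E0 : (0 <= expR (- c) * (q - 1))%R by rewrite mulr_ge0 ?expR_ge0.
have : \esum_(s in [set: G]) (mu s * (expR (- c) * (1 + c)))%:E <=
  \esum_(s in [set: G]) ((mu s `^ q)%:E + (expR (- c) * (q - 1))%:E * (- (mu s * ln (mu s)))%:E).
  by apply: le_esum => s _; rewrite -EFinM -EFinD lee_fin.
have c0 : (0 <= c)%R by rewrite mulr_ge0// shannon_ge0.
under eq_esum do rewrite EFinM.
rewrite esumZr; [|by rewrite lee_fin mulr_ge0 ?expR_ge0 ?addr_ge0|by move=> s; rewrite lee_fin].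
rewrite m.2 mul1e esumD; first last.
- by move=> s _; rewrite -EFinM lee_fin mulr_ge0// entropy_term_ge0.
- by move=> s _; rewrite lee_fin powR_ge0.
rewrite esumZl ?lee_fin//; last by move=> s; rewrite lee_fin entropy_term_ge0.
rewrite -[X in _ <= _ + _ * X]/(shannon_esum mu) -shannonK//.
rewrite -[X in _ <= X + _]/(qmass q (EFin \o mu)) -EFinM -leeBlDr// -EFinB.
rewrite (_ : (_ - _)%R = expR (- c))//.
by rewrite /c; ring.
Qed.

(* Each summand of [rconv mu nu s] is a lower bound for it, so [- ln] of the
   convolution is at most [- ln (mu t) - ln (nu (t^-1 s))]. *)
Lemma shannon_esum_rconv mu nu : prob_measure mu -> prob_measure nu ->
  shannon_esum (rconv mu nu) <= shannon_esum mu + shannon_esum nu.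
Proof.
move=> m n; have m0 := prob_nneg m; have n0 := prob_nneg n.
have P := rconv_prob m n; set L := fun s => (- ln (rconv mu nu s))%R.
have L0 s : (0 <= L s)%R by rewrite oppr_ge0 ln_le0// prob_le1.
pose hm s := (- (mu s * ln (mu s)))%R; pose hn s := (- (nu s * ln (nu s)))%R.
have hm0 s : (0 <= hm s)%R by exact: entropy_term_ge0.
have hn0 s : (0 <= hn s)%R by exact: entropy_term_ge0.
(* Both measures have mass 1, so the entropies are total masses of convolutions. This puts both
   sides in the form of double sums over [s] and [t], compared term by term. *)
have -> : shannon_esum mu + shannon_esum nu =
    \esum_(s in [set: G]) (econv hm (EFin \o nu) s + econv mu (EFin \o hn) s).
  rewrite esumD; first last.
  - by move=> s _; apply: econv_ge0 => // t; rewrite lee_fin.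
  - by move=> s _; apply: econv_ge0 => // t; rewrite lee_fin.
  rewrite !esum_econv//; try by move=> s; rewrite lee_fin.
  by rewrite m.2 n.2 mule1 mul1e.
apply: le_esum => s _; rewrite /econv -esumD; first last.
- by move=> t _; rewrite mule_ge0// lee_fin.
- by move=> t _; rewrite mule_ge0// lee_fin.
rewrite -mulrN EFinM rconvE// /econv -esumZr; first last.
- by move=> t; rewrite mule_ge0// lee_fin.
- by rewrite lee_fin L0.
apply: le_esum => t _; rewrite /= -!EFinM -EFinD lee_fin.
set x := mu t; set y := nu _.
have [xy0|xyn] := eqVneq (x * y)%R 0%R.
  by rewrite xy0 mul0r; apply: addr_ge0; apply: mulr_ge0; rewrite ?hm0 ?hn0 ?m0 ?n0.
have xy : (0 < x * y)%R by rewrite lt_def xyn; exact: mulr_ge0 (m0 t) (n0 _).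
have xp : (0 < x)%R by rewrite lt_def m0 andbT; apply: contra xyn => /eqP->; rewrite mul0r.
have yp : (0 < y)%R by rewrite lt_def n0 andbT; apply: contra xyn => /eqP->; rewrite mulr0.
have le : (x * y <= rconv mu nu s)%R.
  rewrite -lee_fin rconvE//.
  have H0 t' : 0 <= (mu t')%:E * (EFin \o nu) (gmul (ginv t') s).
    by rewrite mule_ge0// lee_fin.
  by apply: le_trans (ge_esum1 t H0); rewrite /= EFinM.
have lnle : (ln x + ln y <= ln (rconv mu nu s))%R.
  by rewrite -lnM ?posrE// ler_ln ?posrE//; exact: lt_le_trans le.
have := ler_wpM2l (ltW xy) lnle.
by rewrite /hm /hn -/x -/y; lra.
Qed.

Lemma convpow_entropy mu n : prob_measure mu -> finite_entropy mu ->
  finite_entropy (convpow mu n).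
Proof.
move=> m h; elim: n => [|n IH].
  rewrite /finite_entropy /shannon_esum esum1// => s _.
  by rewrite /= /delta_e; case: ifP => _; rewrite ?mul0r ?ln1 ?mulr0 oppr0.
apply: le_lt_trans (shannon_esum_rconv m (convpow_prob n m)) _.
exact: lte_add_pinfty.
Qed.

Lemma shannon_convpowD mu m n : prob_measure mu -> finite_entropy mu ->
  (shannon (convpow mu (m + n)) <= shannon (convpow mu m) + shannon (convpow mu n))%R.
Proof.
move=> p h; have P k := convpow_prob k p; have H k := convpow_entropy k p h.
rewrite -lee_fin EFinD !shannonK// convpowD//; exact: shannon_esum_rconv.
Qed.

End Entropy.

Section Fekete.
Context {R : realType}.

(** [l] is the infimum of [u n / n] over [n >= 1], hence the bound valid for each index; [B] keeps
    the infimum finite. *)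
Lemma fekete (u : nat -> R) (B : R) :
  (forall m n, u (m + n)%N <= u m + u n) -> (forall n, - (n%:R * B) <= u n) ->
  exists l : R, (u n / n%:R @[n --> \oo] --> l) /\ (forall n, l * n.+1%:R <= u n.+1).
Proof.
move=> sub lb; pose A := [set u n.+1 / n.+1%:R | n in [set: nat]].
have n0 n : (0 : R) < n.+1%:R by rewrite ltr0n.
have Alb : has_lbound A.
  exists (- B) => _ [n _ <-]; rewrite ler_pdivlMr//.
  by apply: le_trans (lb _); rewrite mulNr mulrC.
have Ai : has_inf A by split => //; exists (u 1%N / 1%:R), 0%N.
have infA n : inf A * n.+1%:R <= u n.+1.
  by rewrite -ler_pdivlMr//; apply: inf_lbound => //; exists n.
exists (inf A); split => //; apply/cvgrPdist_le => e e0.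
have [_ [m _ <-] um] := inf_adherent (divr_gt0 e0 (ltr0n R 2)) Ai.
have mul_sub k : u (k * m.+1)%N <= k%:R * u m.+1 + `|u 0%N|.
  elim: k => [|k IH]; first by rewrite mul0n mul0r add0r ler_norm.
  rewrite mulSn; apply: le_trans (sub _ _) _.
  by rewrite -[k.+1]add1n natrD mulrDl mul1r -addrA lerD2l.
(* For [n = k (m+1) + r], [D] covers what does not grow with [n]: the remainder [u r], the [|u 0|]
   left by the multiples of [m+1], and the error of replacing [k] by [n / (m+1)], a fraction of
   [u m.+1]. *)
pose D := \sum_(r < m.+1) `|u r| + `|u 0%N| + `|u m.+1|.
have D0 : 0 <= D by rewrite !addr_ge0// sumr_ge0.
near=> n.
have np : (0 : R) < n%:R by near: n; exact: nbhs_infty_gtr.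
have nn : n = n.-1.+1 by rewrite prednK// -(ltr0n R).
have lo : inf A <= u n / n%:R by rewrite ler_pdivlMr// nn.
rewrite distrC ger0_norm ?subr_ge0// lerBlDl.
have key : u n <= n%:R * (u m.+1 / m.+1%:R) + D.
  rewrite {1}(divn_eq n m.+1); apply: le_trans (sub _ _) _.
  set k := (n %/ m.+1)%N; set r := (n %% m.+1)%N.
  have rm : (r < m.+1)%N by rewrite ltn_mod.
  have ur : u r <= \sum_(r < m.+1) `|u r|.
    rewrite (bigD1 (Ordinal rm))//=; apply: le_trans (ler_norm _) _.
    by rewrite lerDl sumr_ge0.
  have -> : n%:R * (u m.+1 / m.+1%:R) = k%:R * u m.+1 + r%:R / m.+1%:R * u m.+1 :> R.
    have -> : n%:R = k%:R * m.+1%:R + r%:R :> R by rewrite -natrM -natrD -divn_eq.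
    by field; rewrite lt0r_neq0.
  have : `|r%:R / m.+1%:R * u m.+1| <= `|u m.+1|.
    rewrite normrM ler_piMl// ger0_norm ?divr_ge0//.
    by rewrite ler_pdivrMr// mul1r ler_nat ltnW.
  rewrite ler_norml => /andP[H _].
  move: (mul_sub k) H ur; rewrite /D; set X := (k%:R * _); set Y := (_ / _ * _).
  move: X Y (u _) (u r) (`|u 0%N|) `|u m.+1| (\sum_(_ < _) _) => *; lra.
have De : D <= e / 2 * n%:R.
  rewrite -ler_pdivrMl ?divr_gt0// ltW//; near: n; exact: nbhs_infty_gtr.
rewrite ler_pdivrMr//; apply: le_trans key _.
have : n%:R * (u m.+1 / m.+1%:R) <= n%:R * (inf A + e / 2).
  by rewrite ler_wpM2l ?ler0n// ltW.
move=> H; apply: le_trans (lerD H De) _.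
by rewrite le_eqVlt; apply/orP; left; apply/eqP; field.
Unshelve. all: by end_near.
Qed.

End Fekete.

(** * Convolution operators on complex l^q *)

Section MoreSums.
Context {R : realType} {I J : choiceType}.

Lemma csumI_reindex (e : I -> J) (f : J -> R[i]) : bijective e ->
  csumI f = csumI (f \o e).
Proof.
by move=> be; rewrite /csumI /rsumI; congr Complex;
  rewrite !(esum_reindex _ be).
Qed.

Lemma csumI_ge0E (u : I -> R) : (forall i, 0 <= u i) ->
  csumI (fun i => (u i)%:C%C) = (fine (\esum_(i in [set: I]) (u i)%:E))%:C%C.
Proof.
move=> u0; apply: eqc => /=; first by rewrite rsumI_ge0E.
by rewrite rsumI_ge0E// esum1.
Qed.

Lemma csumI_nat_recl (f : nat -> R[i]) : cabs_summable f ->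
  csumI f = f 0%N + csumI (fun n => f n.+1).
Proof.
have rec (u : nat -> R) : abs_summable u -> rsumI u = u 0%N + rsumI (fun n => u n.+1).
  move=> us; have sS : abs_summable (fun n => u n.+1).
    apply: le_lt_trans us; rewrite [leRHS]esum_nat_recl//.
    by rewrite leeDr.
  have pu := summable_le (posp_le _) sS; have nu := summable_le (negp_le _) sS.
  have pE := esum_nat_recl (fun n => (posp_ge0 u n : (0 <= (posp u n)%:E)%E)).
  have nE := esum_nat_recl (fun n => (negp_ge0 u n : (0 <= (negp u n)%:E)%E)).
  have pf : (\esum_(n in [set: nat]) (posp (fun n => u n.+1) n)%:E)%E \is a fin_num.
    by rewrite ge0_fin_numE// esum_ge0// => i _; exact: posp_ge0.
  have nf : (\esum_(n in [set: nat]) (negp (fun n => u n.+1) n)%:E)%E \is a fin_num.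
    by rewrite ge0_fin_numE// esum_ge0// => i _; exact: negp_ge0.
  rewrite {1}/rsumI pE nE !fineD// [in RHS](pospBnegp u 0%N) /rsumI /posp /negp /=; ring.
move=> fs; apply: eqc; rewrite ?ReD ?ImD /= rec//.
  exact: cabs_summable_Re.
exact: cabs_summable_Im.
Qed.

Lemma csumI_sum N (F : nat -> I -> R[i]) : (forall n, cabs_summable (F n)) ->
  csumI (fun i => \sum_(n < N) F n i) = \sum_(n < N) csumI (F n) /\
  cabs_summable (fun i => \sum_(n < N) F n i).
Proof.
move=> Fs; elim: N => [|N [IH1 IH2]].
  have -> : (fun i : I => \sum_(n < 0) F n i) = fun=> 0.
    by apply/funext => i; rewrite big_ord0.
  rewrite big_ord0; split.
    by apply: eqc => /=; rewrite rsumI_ge0E// esum1.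
  by rewrite /cabs_summable esum1// => i _; rewrite ComplexField.Normc.normc0.
have -> : (fun i : I => \sum_(n < N.+1) F n i) = fun i => \sum_(n < N) F n i + F N i.
  by apply/funext => i; rewrite big_ord_recr.
by rewrite csumID// IH1 big_ord_recr; split => //; exact: cabs_summableD.
Qed.

End MoreSums.

Section LqOperators.
Context {R : realType} {G : cgroup}.
Variable q : R.
Hypothesis q1 : 1 < q.
Local Notation C := (R[i]).
Local Notation nrm := (@ComplexField.Normc.normc R).
Implicit Types (g h : G -> C) (mu nu : G -> R) (f : G -> \bar R).

Let q0 : 0 < q. Proof. exact: lt_trans q1. Qed.
Let qn0 : q != 0. Proof. exact: lt0r_neq0. Qed.

Definition absf g : G -> \bar R := fun s => (nrm (g s))%:E.
Definition cfun nu : G -> C := fun s => ((nu s)%:C)%C.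

Lemma absf_ge0 g s : (0 <= absf g s)%E.
Proof. by rewrite lee_fin normc_ge0. Qed.

Lemma lqE g : lq q g = (qmass q (absf g) < +oo)%E.
Proof. by []. Qed.

Lemma lqnormE g : lqnorm q g = fine (qmass q (absf g)) `^ q^-1.
Proof. by []. Qed.

Lemma lq_zero : lq q (fun _ : G => 0 : C).
Proof.
rewrite lqE (_ : absf _ = fun=> 0%E) ?qmass0//.
by apply/funext => s; rewrite /absf ComplexField.Normc.normc0.
Qed.

Lemma qmass_fin_num g : lq q g -> qmass q (absf g) \is a fin_num.
Proof. by move=> gq; rewrite ge0_fin_numE// qmass_ge0. Qed.

Lemma opnorm_le (A : op R G) (B : R) : 0 <= B ->
  (forall g, lq q g -> (qmass q (absf (A g)) <= B%:E * qmass q (absf g))%E) ->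
  (opnorm q A <= (B `^ q^-1)%:E)%E.
Proof.
move=> B0 H; apply: ge_ereal_sup => _ [g [gq g1] <-]; rewrite lee_fin.
rewrite lqnormE in g1; have gf := qmass_fin_num gq.
have e1 : fine (qmass q (absf g)) <= 1.
  rewrite leNgt; apply/negP => e1; move: g1; rewrite leNgt => /negP; apply.
  rewrite (_ : 1 = 1 `^ q^-1); last by rewrite powR1.
  apply: gt0_ltr_powR; rewrite ?invr_gt0// ?nnegrE//.
  by rewrite fine_ge0// qmass_ge0.
have Hg := H _ gq; have Af : qmass q (absf (A g)) \is a fin_num.
  rewrite ge0_fin_numE ?qmass_ge0//; apply: le_lt_trans Hg _.
  by rewrite -(fineK gf) -EFinM ltry.
rewrite lqnormE; apply: ge0_ler_powR; rewrite ?nnegrE ?invr_ge0 ?(ltW q0)//.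
  by rewrite fine_ge0// qmass_ge0.
move: Hg; rewrite -(fineK gf) -(fineK Af) -EFinM lee_fin => /le_trans; apply.
by rewrite ler_piMr.
Qed.

Lemma lq_le g f : (forall s, (absf g s <= f s)%E) -> (qmass q f < +oo)%E -> lq q g.
Proof.
move=> gf; rewrite lqE; apply: le_lt_trans; apply: le_qmass => //; exact: absf_ge0.
Qed.

(* The crude constant of the quasi-triangle inequality suffices. *)
Lemma qmass_add_le f1 f2 : (forall s, (0 <= f1 s)%E) -> (forall s, (0 <= f2 s)%E) ->
  (qmass q (fun s => f1 s + f2 s) <= (2 `^ q)%:E * (qmass q f1 + qmass q f2))%E.
Proof.
move=> f10 f20; rewrite /qmass -esumD; first last.
- by move=> s _; exact: poweR_ge0.
- by move=> s _; exact: poweR_ge0.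
rewrite -esumZl; first last.
- by move=> s; rewrite adde_ge0// poweR_ge0.
- by rewrite lee_fin powR_ge0.
apply: le_esum => s _.
wlog le12 : f1 f2 f10 f20 / (f1 s <= f2 s)%E.
  move=> H; have [|/ltW] := leP (f1 s) (f2 s); first exact: H.
  by move=> ?; rewrite addeC [X in (_ * X)%E]addeC; apply: H.
apply: (@le_trans _ _ ((2%:E * f2 s) `^ q)%E).
  apply: le_poweR; [exact: ltW|exact: adde_ge0|].
  by rewrite (_ : 2 = 1 + 1 :> R) ?EFinD ?ge0_muleDl// ?mul1e ?leeD.
rewrite poweRM// poweR_EFin; apply: lee_wpmul2l; first by rewrite lee_fin powR_ge0.
by rewrite leeDr// poweR_ge0.
Qed.

Lemma qmass_lin_le (a : C) g h :
  (qmass q (absf (fun s => a * g s + h s)%R) <=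
   (2 `^ q)%:E * ((nrm a `^ q)%:E * qmass q (absf g) + qmass q (absf h)))%E.
Proof.
have -> : ((nrm a `^ q)%:E * qmass q (absf g) = qmass q (fun s => (nrm a)%:E * absf g s))%E.
  by rewrite qmassZ// ?lee_fin ?normc_ge0// => s; exact: absf_ge0.
apply: le_trans (qmass_add_le _ _); first last.
- by move=> s; exact: absf_ge0.
- by move=> s; rewrite mule_ge0// lee_fin normc_ge0.
apply: le_qmass => // s; first exact: absf_ge0.
by rewrite /absf -EFinM -EFinD lee_fin -ComplexField.Normc.normcM normcD.
Qed.

Lemma lq_lin (a : C) g h : lq q g -> lq q h -> lq q (fun s => a * g s + h s).
Proof.
move=> gq hq; rewrite lqE; apply: le_lt_trans (qmass_lin_le _ _ _) _.
rewrite -(fineK (qmass_fin_num gq)) -(fineK (qmass_fin_num hq)).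
exact: ltry.
Qed.

Section Lambda.
Variable nu : G -> R.
Hypothesis n : prob_measure nu.
Let n0 := prob_nneg n.

Lemma lambda_term g s t :
  ((nrm (cfun nu t * g (gmul (ginv t) s)))%:E = (nu t)%:E * absf g (gmul (ginv t) s))%E.
Proof. by rewrite ComplexField.Normc.normcM normc_real ger0_norm// EFinM. Qed.

Lemma econv_fin f s : (forall s, (0 <= f s)%E) -> (qmass q f < +oo)%E -> (econv nu f s < +oo)%E.
Proof.
move=> f0 fq; apply: (qmass_fin q1); first by move=> ?; exact: econv_ge0.
exact: le_lt_trans (qmass_econv_prob q1 n f0) fq.
Qed.

Lemma lambda_summable g s : lq q g -> cabs_summable (fun t => cfun nu t * g (gmul (ginv t) s)).
Proof.
move=> gq; rewrite /cabs_summable; under eq_esum do rewrite lambda_term.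
by apply: econv_fin => //; exact: absf_ge0.
Qed.

(** The bridge from complex to nonnegative functions: since the kernel is nonnegative, the triangle
    inequality loses nothing in the kernel. *)
Lemma absf_lambda_le g s : lq q g -> (absf (lambda (cfun nu) g) s <= econv nu (absf g) s)%E.
Proof.
move=> gq; apply: le_trans (normc_csumI_le (lambda_summable s gq)) _.
by apply: le_esum => t _; rewrite lambda_term.
Qed.

Lemma lambda_lq g : lq q g -> lq q (lambda (cfun nu) g).
Proof.
move=> gq; apply: (@lq_le _ (econv nu (absf g))) => [s|]; first exact: absf_lambda_le.
by apply: le_lt_trans gq; apply: qmass_econv_prob => //; exact: absf_ge0.
Qed.

Lemma qmass_lambda_le g : lq q g ->
  (qmass q (absf (lambda (cfun nu) g)) <= opq q nu * qmass q (absf g))%E.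
Proof.
move=> gq; apply: (@le_trans _ _ (qmass q (econv nu (absf g)))).
  by apply: le_qmass => // s; [exact: absf_ge0|exact: absf_lambda_le].
by apply: opq_bound => //; exact: absf_ge0.
Qed.

Lemma lambda_lin (a : C) g h s : lq q g -> lq q h ->
  lambda (cfun nu) (fun s => a * g s + h s) s = a * lambda (cfun nu) g s + lambda (cfun nu) h s.
Proof.
move=> gq hq; rewrite -[LHS]/(csumI _) -[lambda _ g s]/(csumI _) -[lambda _ h s]/(csumI _).
rewrite -csumI_lin; [|exact: lambda_summable..].
by apply: eq_csumI => t; rewrite mulrDr mulrCA.
Qed.

End Lambda.

Lemma lambda_rconv mu nu g : prob_measure mu -> prob_measure nu -> lq q g ->
  lambda (cfun (rconv mu nu)) g = lambda (cfun mu) (lambda (cfun nu) g).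
Proof.
move=> m n gq; have m0 := prob_nneg m; have n0 := prob_nneg n; apply/funext => s.
pose F x t : C := (cfun mu t * cfun nu (gmul (ginv t) x)) * g (gmul (ginv x) s).
have sx x : cabs_summable (fun t => cfun mu t * cfun nu (gmul (ginv t) x)).
  rewrite /cabs_summable.
  under eq_esum do rewrite ComplexField.Normc.normcM !normc_real !ger0_norm// EFinM.
  by rewrite -[X in (X < _)%E]/(econv mu (EFin \o nu) x) -rconvE// ltry.
transitivity (csumI (fun x => csumI (F x))).
  apply: eq_csumI => x; rewrite /F; under eq_csumI do rewrite mulrC.
  rewrite csumIZ// mulrC; congr (_ * _).
  transitivity (csumI (fun t => ((mu t * nu (gmul (ginv t) x))%:C)%C)).
    rewrite csumI_ge0E; last by move=> t; rewrite mulr_ge0.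
    congr (_%:C)%C; apply: EFin_inj; rewrite rconvE// fineK.
      by apply: eq_esum => t _; rewrite EFinM.
    under eq_esum do rewrite EFinM.
    by rewrite -[X in X \is a _]/(econv mu (EFin \o nu) x) -rconvE.
  by apply: eq_csumI => t; rewrite rmorphM.
rewrite csumI_fubini.
  apply: eq_csumI => t; rewrite (csumI_reindex _ (gmul_bij t)) /=.
  rewrite -[lambda _ g _]/(csumI _) -csumIZ; last exact: lambda_summable.
  by apply: eq_csumI => u /=; rewrite /F gmulKV ginvM -gmulA mulrA.
(* The double sum of moduli is itself a convolution of [|g|] by a probability; it has finite q-mass,
   hence finite values. *)
rewrite (_ : esum _ _ = econv (rconv mu nu) (absf g) s).
  by apply: econv_fin => //; [exact: rconv_prob|exact: absf_ge0].
apply: eq_esum => x _; rewrite rconvE// /econv -esumZr; first last.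
- by move=> t; rewrite mule_ge0// lee_fin.
- exact: absf_ge0.
apply: eq_esum => t _.
by rewrite /F !ComplexField.Normc.normcM !normc_real !ger0_norm// !EFinM.
Qed.

(** Shows that a partial Neumann sum is convolution by a single function; with [l1_sum] it becomes
    an approximant of the kind [PF] requires. *)
Lemma lambda_sum N (c : nat -> C) (K : nat -> G -> R) g :
  (forall n, prob_measure (K n)) -> lq q g ->
  lambda (fun s => \sum_(n < N) c n * cfun (K n) s) g =
  fun s => \sum_(n < N) c n * lambda (cfun (K n)) g s.
Proof.
move=> p gq; apply/funext => s.
have H n : cabs_summable (fun t => c n * (cfun (K n) t * g (gmul (ginv t) s))).
  by apply: cabs_summableZ; exact: lambda_summable.
transitivity (csumI (fun t => \sum_(n < N) c n * (cfun (K n) t * g (gmul (ginv t) s)))).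
  by apply: eq_csumI => t; rewrite mulr_suml; apply: eq_bigr => n _; rewrite mulrA.
rewrite (csumI_sum N H).1; apply: eq_bigr => n _.
by rewrite csumIZ//; exact: lambda_summable.
Qed.

Lemma l1_sum N (c : nat -> C) (K : nat -> G -> R) :
  (forall n, prob_measure (K n)) -> l1 (fun s => \sum_(n < N) c n * cfun (K n) s).
Proof.
move=> p; have H n : cabs_summable (fun t => c n * cfun (K n) t).
  apply: cabs_summableZ; rewrite /cabs_summable.
  under eq_esum do rewrite normc_real ger0_norm ?prob_nneg//.
  by rewrite (p n).2 ltry.
exact: (csumI_sum N H).2.
Qed.

End LqOperators.

(** * The resolvent outside the spectral disc *)

Lemma powRX {R : realType} (x y : R) n : 0 <= x -> (x ^+ n) `^ y = (x `^ y) ^+ n.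
Proof.
by move=> x0; rewrite -(powR_mulrn n (powR_ge0 x y)) -powRrM -(powR_mulrn n x0) -powRrM mulrC.
Qed.

Lemma esum_geometric {R : realType} (x : R) : 0 < x < 1 ->
  (\esum_(n in [set: nat]) (x ^+ n)%:E < +oo)%E.
Proof.
move=> /andP[x0 x1]; rewrite -nneseries_esumT; last first.
  by move=> n; rewrite lee_fin exprn_ge0// ltW.
apply: (@le_lt_trans _ _ ((1 * (1 - x)^-1)%:E)%E); last exact: ltry.
apply: lime_le.
  by apply: is_cvg_nneseries => n _ _; rewrite lee_fin exprn_ge0// ltW.
apply: nearW => n; rewrite sumEFin lee_fin.
have := @geometric_le_lim R n 1 x ler01 x0.
rewrite (ger0_norm (ltW x0)) => /(_ x1); apply: le_trans; rewrite /series/=.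
by apply: ler_sum => i _; rewrite mul1r.
Qed.

Lemma rsumI_delta {R : realType} {I : choiceType} (i : I) (x : R) :
  rsumI (fun j => if j == i then x else 0) = x.
Proof.
rewrite /rsumI.
have E (y : R) : 0 <= y -> fine (\esum_(j in [set: I]) (if j == i then y else 0)%:E) = y.
  move=> y0; transitivity (fine (\esum_(j in [set: I]) (if j == i then y%:E else 0))).
    by congr fine; apply: eq_esum => j _; case: ifP.
  by rewrite (@esum_delta _ _ i (fun=> y%:E)).
rewrite -[RHS](_ : Num.max x 0 - Num.max (- x) 0 = x); last first.
  exact: esym (pospBnegp (fun=> x) tt).
rewrite -[in RHS](E (Num.max x 0)) ?le_max ?lexx ?orbT//.
rewrite -[X in _ = _ - X](E (Num.max (- x) 0)) ?le_max ?lexx ?orbT//.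
by congr (fine _ - fine _); apply: eq_esum => j _; case: ifP => _//; rewrite ?oppr0 maxxx.
Qed.

Lemma lambda_delta {R : realType} {G : cgroup} (g : G -> R[i]) :
  lambda (cfun (@delta_e R G)) g = g.
Proof.
apply/funext => s.
transitivity (csumI (fun t : G => if t == gone G then g s else 0)).
  apply: eq_csumI => t; rewrite /cfun /delta_e; case: eqVneq => [->|_].
    by rewrite ginv1 gmul1 mul1r.
  by rewrite mul0r.
apply: eqc => /=; rewrite -[RHS](rsumI_delta (gone G)); apply: eq_rsumI => t;
  by case: ifP.
Qed.

Section Neumann.
Context {R : realType} {G : cgroup}.
Variables (q : R) (mu : G -> R) (r B : R).
Hypothesis q1 : 1 < q.
Hypothesis m : prob_measure mu.
Hypothesis r0 : 0 < r.
Hypothesis B0 : 0 <= B.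
(** [r] will be a radius strictly between the spectral radius and the modulus of [z]; [B] absorbs
    the finitely many [n] before the growth bound sets in. *)
Hypothesis powB : forall n, (opq q (convpow mu n) <= (B * (r `^ q) ^+ n)%:E)%E.
Local Notation C := (R[i]).
Local Notation nrm := (@ComplexField.Normc.normc R).
Local Notation T n := (lambda (cfun (convpow mu n))).
Implicit Types (g h : G -> C) (f : G -> \bar R).

Let q0 : 0 < q. Proof. exact: lt_trans q1. Qed.
Let qn0 : q != 0. Proof. exact: lt0r_neq0. Qed.
Let P n : prob_measure (convpow mu n). Proof. exact: convpow_prob. Qed.
Let P0 n : nneg (convpow mu n). Proof. exact: prob_nneg. Qed.

(* A weighted Jensen inequality, in place of Minkowski's inequality for series. *)
Lemma qmass_power_series_le (w : nat -> R) f : (forall n, 0 <= w n) ->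
  (forall s, (0 <= f s)%E) -> (qmass q f < +oo)%E ->
  (qmass q (fun s => \esum_(n in [set: nat]) ((w n)%:E * econv (convpow mu n) f s)) <=
   (\esum_(n in [set: nat]) (w n * r ^+ n)%:E) `^ q * (B%:E * qmass q f))%E.
Proof.
(* Moving [r^n] into the weight leaves [r^-n T^n f], whose q-mass is at most [B] times that of [f]
   for every [n]. Hoelder with weights [v] yields [W^(q-1)], and the sum of the weights yields the
   last factor [W]. *)
move=> w0 f0 fq; pose v n := w n * r ^+ n; set W := (X in (X `^ q)%E).
have v0 n : 0 <= v n by rewrite mulr_ge0// exprn_ge0// ltW.
have rn n : r ^+ n != 0 by rewrite expf_neq0// lt0r_neq0.
have W0 : (0 <= W)%E by apply: esum_ge0 => n _; rewrite lee_fin v0.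
have F0 n s : (0 <= econv (convpow mu n) f s)%E by exact: econv_ge0.
pose X n s := ((((r ^+ n)^-1)%:E * econv (convpow mu n) f s) `^ q)%E.
have X0 n s : (0 <= X n s)%E by exact: poweR_ge0.
have i0 n : (0 <= ((r ^+ n)^-1)%:E :> \bar R)%E by rewrite lee_fin invr_ge0 exprn_ge0// ltW.
have vX0 s n : (0 <= (v n)%:E * X n s)%E by rewrite mule_ge0// lee_fin.
have t01 : 0 < 1 - q^-1 < 1.
  by rewrite subr_gt0 invf_lt1// q1 gtrBl invr_gt0.
have step s : ((\esum_(n in [set: nat]) ((w n)%:E * econv (convpow mu n) f s)) `^ q <=
     (\esum_(n in [set: nat]) ((v n)%:E * X n s)) * W `^ (q - 1))%E.
  have := @hoelder_esum R nat (1 - q^-1) v (fun n => X n s) (fun=> 1%E) t01 v0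
     (fun n => X0 n s) (fun=> lee01).
  have e1 : 1 - (1 - q^-1) = q^-1 by rewrite opprB addrCA subrr addr0.
  under eq_esum do
    rewrite poweR1r mule1 e1 /X -poweRrM divff// poweRe1 ?mule_ge0// muleA -EFinM /v mulfK//.
  under [X in (_ <= _ * X `^ _ -> _)%E]eq_esum do rewrite mule1.
  rewrite e1 -/W => H.
  apply: le_trans (le_poweR (ltW q0) _ H) _.
    by apply: esum_ge0 => n _; rewrite mule_ge0// lee_fin.
  rewrite poweRM ?poweR_ge0// -!poweRrM mulVf// poweRe1 ?esum_ge0//.
  by rewrite mulrBl mul1r mulVf.
apply: le_trans (le_esum (fun s _ => step s)) _.
rewrite esumZr ?poweR_ge0//; last by move=> s; exact: esum_ge0.
rewrite exchange_esum//.
have -> : (W `^ q = W * W `^ (q - 1))%E.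
  rewrite -{2}[W]poweRe1// -poweRD; last by rewrite poweRD_defE addrCA subrr addr0 (negbTE qn0).
  by rewrite addrCA subrr addr0.
rewrite muleAC; apply: lee_wpmul2r; first exact: poweR_ge0.
rewrite -esumZr; [|by rewrite mule_ge0 ?qmass_ge0// lee_fin|by move=> n; rewrite lee_fin v0].
apply: le_esum => n _; rewrite esumZl ?lee_fin//; apply: lee_wpmul2l; first by rewrite lee_fin.
rewrite -[leLHS]/(qmass q (fun s => (((r ^+ n)^-1)%:E * econv (convpow mu n) f s)%E)).
rewrite qmassZ//.
apply: (@le_trans _ _ (((r ^+ n)^-1 `^ q)%:E * ((B * (r `^ q) ^+ n)%:E * qmass q f))%E).
  apply: lee_wpmul2l; first by rewrite lee_fin powR_ge0.
  apply: le_trans (opq_bound q1 (P0 n) f0 fq) _.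
  by apply: lee_wpmul2r => //; exact: qmass_ge0.
rewrite muleA -EFinM; apply: lee_wpmul2r; first exact: qmass_ge0.
have rq := powRX q n (ltW r0).
have rqV : (r ^+ n)^-1 `^ q = ((r ^+ n) `^ q)^-1.
  by rewrite -powR_inv1 ?exprn_ge0 ?(ltW r0)// -powRrM mulN1r powRN.
by rewrite lee_fin rqV rq mulrCA mulVf ?mulr1// expf_neq0// lt0r_neq0// powR_gt0.
Qed.

Lemma lambda_convpow0 g : T 0 g = g.
Proof. exact: lambda_delta. Qed.

Lemma lambda_convpowS n g : lq q g -> T n.+1 g = lambda (cfun mu) (T n g).
Proof. by move=> gq; rewrite -[LHS]/(lambda (cfun (rconv mu (convpow mu n))) g) (lambda_rconv q1). Qed.

Lemma lambda_convpow_lq n g : lq q g -> lq q (T n g).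
Proof. exact: lambda_lq. Qed.

Lemma lambda_convpowSr n g : lq q g -> T n.+1 g = T n (lambda (cfun mu) g).
Proof.
move=> gq; have lgq : lq q (lambda (cfun mu) g) by exact: lambda_lq.
elim: n => [|n IH]; first by rewrite (lambda_convpowS 0 gq) !lambda_convpow0.
by rewrite (lambda_convpowS n.+1 gq) IH -(lambda_convpowS n lgq).
Qed.

Variable z : C.
Hypothesis rz : r < nrm z.

Let nz0 : 0 < nrm z. Proof. exact: lt_trans rz. Qed.
Let z0 : z != 0.
Proof. by apply: contraTneq nz0 => ->; rewrite ComplexField.Normc.normc0 ltxx. Qed.

Let c n : C := z^-1 ^+ n.+1.

Lemma normcX (x : C) n : nrm (x ^+ n) = nrm x ^+ n.
Proof.
elim: n => [|n IH]; first by rewrite !expr0 ComplexField.Normc.normc1.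
by rewrite !exprS ComplexField.Normc.normcM IH.
Qed.

Let cE n : nrm (c n) = (nrm z)^-1 ^+ n.+1.
Proof. by rewrite normcX ComplexField.Normc.normcV. Qed.

Definition resolvent : op R G := fun g s => csumI (fun n => c n * T n g s).

Let W := (\esum_(n in [set: nat]) (nrm (c n) * r ^+ n)%:E)%E.

Let W_fin : (W < +oo)%E.
Proof.
have x01 : 0 < r / nrm z < 1 by rewrite divr_gt0//= ltr_pdivrMr// mul1r.
rewrite /W; under eq_esum do rewrite cE exprS -mulrA -exprMn [_^-1 * r]mulrC EFinM.
rewrite esumZl ?lee_fin ?invr_ge0 ?ltW//.
  by apply: lte_mul_pinfty; rewrite ?lee_fin ?invr_ge0 ?normc_ge0// esum_geometric.
by move=> n; rewrite lee_fin exprn_ge0// divr_ge0// ltW.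
Qed.

Let W0 : (0 <= W)%E.
Proof. by apply: esum_ge0 => n _; rewrite lee_fin mulr_ge0 ?normc_ge0// exprn_ge0// ltW. Qed.

(** Majorant of the Neumann series. Its finite q-mass gives pointwise absolute convergence,
    stability of l^q and the norm bound at once. *)
Let maj g s := (\esum_(n in [set: nat]) ((nrm (c n))%:E * econv (convpow mu n) (absf g) s))%E.

Let qmass_maj g : lq q g -> (qmass q (maj g) <= W `^ q * (B%:E * qmass q (absf g)))%E.
Proof.
move=> gq; apply: qmass_power_series_le => //.
  by move=> n; exact: normc_ge0.
by move=> s; exact: absf_ge0.
Qed.

Let maj_ge0 g s : (0 <= maj g s)%E.
Proof.
apply: esum_ge0 => n _; rewrite mule_ge0 ?lee_fin ?normc_ge0//.
by apply: econv_ge0 => // ?; exact: absf_ge0.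
Qed.

Let D : R := fine (W `^ q) * B.

Let qmass_majD g : lq q g -> (qmass q (maj g) <= D%:E * qmass q (absf g))%E.
Proof.
move=> gq; apply: le_trans (qmass_maj gq) _.
by rewrite /D EFinM fineK ?muleA// fin_num_poweR// ge0_fin_numE.
Qed.

Let D0 : 0 <= D. Proof. by rewrite mulr_ge0// fine_ge0// poweR_ge0. Qed.

Let qmass_maj_fin g : lq q g -> (qmass q (maj g) < +oo)%E.
Proof.
move=> gq; apply: le_lt_trans (qmass_majD gq) _.
by rewrite -(fineK (qmass_fin_num gq)); exact: ltry.
Qed.

Let term_le g s : lq q g ->
  (\esum_(n in [set: nat]) (nrm (c n * T n g s))%:E <= maj g s)%E.
Proof.
move=> gq; apply: le_esum => n _; rewrite ComplexField.Normc.normcM EFinM.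
apply: lee_wpmul2l; first by rewrite lee_fin normc_ge0.
exact: (absf_lambda_le q1 (P n) s gq).
Qed.

Let term_summable g s : lq q g -> cabs_summable (fun n => c n * T n g s).
Proof.
move=> gq; apply: le_lt_trans (term_le s gq) _; apply: (qmass_fin q1) => //.
exact: qmass_maj_fin.
Qed.

Let absf_resolvent_le g s : lq q g -> (absf (resolvent g) s <= maj g s)%E.
Proof.
by move=> gq; apply: le_trans (normc_csumI_le (term_summable s gq)) _; exact: term_le.
Qed.

Let qmass_resolvent_le g : lq q g ->
  (qmass q (absf (resolvent g)) <= D%:E * qmass q (absf g))%E.
Proof.
move=> gq; apply: le_trans (qmass_majD gq); apply: le_qmass => // s.
  exact: absf_ge0.
exact: absf_resolvent_le.
Qed.

Let resolvent_lq g : lq q g -> lq q (resolvent g).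
Proof. by move=> gq; apply: lq_le (qmass_maj_fin gq) => // s; exact: absf_resolvent_le. Qed.

Let resolvent_lin (a : C) g h : lq q g -> lq q h ->
  resolvent (fun s => a * g s + h s) = fun s => a * resolvent g s + resolvent h s.
Proof.
move=> gq hq; apply/funext => s; rewrite /resolvent -csumI_lin; [|exact: term_summable..].
by apply: eq_csumI => n; rewrite (lambda_lin q1)// mulrDr mulrCA.
Qed.

Let resolvent_bounded : bounded_op q resolvent.
Proof.
split; [exact: resolvent_lq|exact: resolvent_lin|].
exact: le_lt_trans (opnorm_le q1 D0 qmass_resolvent_le) (ltry _).
Qed.

(** Exchange of the sums over the group and over [n], justified by [mu * maj g], which is finite at
    every point. It makes the left inverse a right inverse as well. *)
Let resolvent_lambda g : lq q g -> lambda (cfun mu) (resolvent g) = resolvent (lambda (cfun mu) g).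
Proof.
move=> gq; apply/funext => s.
pose F t n : C := cfun mu t * (c n * T n g (gmul (ginv t) s)).
transitivity (csumI (fun t => csumI (F t))).
  by apply: eq_csumI => t; rewrite csumIZ//; exact: term_summable.
rewrite csumI_fubini; last first.
  apply: (@le_lt_trans _ _ (econv mu (maj g) s)).
    apply: le_esum => t _; rewrite /F.
    under eq_esum do rewrite ComplexField.Normc.normcM normc_real ger0_norm ?prob_nneg// EFinM.
    rewrite esumZl ?lee_fin ?prob_nneg//; last by move=> n; rewrite lee_fin normc_ge0.
    by apply: lee_wpmul2l; rewrite ?lee_fin ?prob_nneg// term_le.
  by apply: (econv_fin q1) => //; exact: qmass_maj_fin.
apply: eq_csumI => n; rewrite -lambda_convpowSr// lambda_convpowS//.
rewrite -[lambda _ (T n g) s]/(csumI _) -csumIZ; last first.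
  by apply: (lambda_summable q1) => //; exact: lambda_convpow_lq.
by apply: eq_csumI => t; rewrite /F mulrCA.
Qed.

Let lambda_mu_lq g : lq q g -> lq q (lambda (cfun mu) g).
Proof. exact: lambda_lq. Qed.

Let linE g : (fun s => z * g s - lambda (cfun mu) g s) =
  (fun s => -1 * lambda (cfun mu) g s + z * g s).
Proof. by apply/funext => s; rewrite mulN1r addrC. Qed.

Let lqZ (a : C) g : lq q g -> lq q (fun s => a * g s).
Proof.
move=> gq; rewrite (_ : (fun s => _) = fun s => a * g s + 0).
  exact: lq_lin gq (lq_zero q1).
by apply/funext => s; rewrite addr0.
Qed.

Let lambda_convpowZ n (a : C) h s : lq q h -> T n (fun s => a * h s) s = a * T n h s.
Proof.
move=> hq; rewrite -[LHS]/(csumI _) -csumIZ; last exact: (lambda_summable q1 (P n)).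
by apply: eq_csumI => t; rewrite mulrCA.
Qed.

Let resolventZ (a : C) g s : lq q g -> resolvent (fun s => a * g s) s = a * resolvent g s.
Proof.
move=> gq; rewrite /resolvent -csumIZ; last exact: term_summable.
by apply: eq_csumI => n; rewrite mulrCA lambda_convpowZ.
Qed.

Let resolventK g : lq q g -> resolvent (fun s => z * g s - lambda (cfun mu) g s) = g.
Proof.
move=> gq; rewrite linE resolvent_lin; [|exact: lambda_mu_lq|exact: lqZ].
apply/funext => s; rewrite resolventZ// mulN1r.
(* [z * c n.+1 = c n]: the series for [T g] is [z] times the series for [g] without its first term,
   so only [z * c 0 * g = g] survives in the difference. *)
have -> : resolvent (lambda (cfun mu) g) s = csumI (fun n => z * (c n.+1 * T n.+1 g s)).
  apply: eq_csumI => n; rewrite -lambda_convpowSr// mulrA; congr (_ * _).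
  by rewrite /c [in RHS]exprS mulrA divff// mul1r.
rewrite /resolvent -csumIZ; last exact: term_summable.
have zs : cabs_summable (fun n => z * (c n * T n g s)).
  by apply: cabs_summableZ; exact: term_summable.
rewrite (csumI_nat_recl zs) addrCA addNr addr0 lambda_convpow0.
by rewrite /c expr1 mulrA divff// mul1r.
Qed.

Let resolventVK g : lq q g ->
  (fun s => z * resolvent g s - lambda (cfun mu) (resolvent g) s) = g.
Proof.
move=> gq; rewrite resolvent_lambda// -[RHS]resolventK// linE resolvent_lin;
  [|exact: lambda_mu_lq|exact: lqZ].
by apply/funext => s; rewrite resolventZ// mulN1r addrC.
Qed.

Let partial N : op R G := fun g s => \sum_(n < N) c n * T n g s.

Let telescope N (x : nat -> C) :
  \sum_(n < N) c n * (- x n.+1 + z * x n) = x 0%N - z^-1 ^+ N * x N.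
Proof.
elim: N => [|N IH]; first by rewrite big_ord0 expr0 mul1r subrr.
rewrite big_ord_recr/= IH.
have -> : c N * (- x N.+1 + z * x N) = - (c N * x N.+1) + (c N * z) * x N by ring.
have -> : c N * z = z^-1 ^+ N by rewrite /c exprSr mulfVK.
by rewrite /c; ring.
Qed.

Let partialE N h s : lq q h ->
  partial N (fun s => z * h s - lambda (cfun mu) h s) s = h s - z^-1 ^+ N * T N h s.
Proof.
move=> hq; rewrite linE.
transitivity (\sum_(n < N) c n * (- T n.+1 h s + z * T n h s)); last first.
  by rewrite (telescope N (fun n => T n h s)) lambda_convpow0.
apply: eq_bigr => n _; congr (_ * _).
rewrite (lambda_lin q1 (P n) (-1) s (lambda_mu_lq hq) (lqZ z hq)).
by rewrite lambda_convpowZ// -(lambda_convpowSr n hq) mulN1r.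
Qed.

Let resolvent_PF : PF q resolvent.
Proof.
split=> [//|e e0].
(* the error after N terms is [z^-N T^N] applied to the resolvent *)
have [N HN] : exists N, ((B * D) `^ q^-1) * (r / nrm z) ^+ N < e.
  have x1 : `|r / nrm z| < 1 by rewrite ger0_norm ?divr_ge0 ?ltW// ltr_pdivrMr// mul1r.
  have /cvgrPdist_lt/(_ e e0)[N _ /(_ N (leqnn N))] :=
    @cvg_geometric R ((B * D) `^ q^-1) _ x1.
  rewrite sub0r normrN ger0_norm/=; first by exists N.
  by rewrite mulr_ge0 ?powR_ge0// exprn_ge0// divr_ge0 ?ltW.
exists (fun s => \sum_(n < N) c n * cfun (convpow mu n) s); split; first exact: l1_sum.
(* Bound for the q-th power of the error: [B r^(qN)] from [T^N], [D] from the resolvent, [|z|^(-qN)]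
   from the coefficient. *)
pose E := B * D * ((r / nrm z) `^ q) ^+ N.
have x0 : 0 <= r / nrm z by rewrite divr_ge0 ?ltW.
have BD0 : 0 <= B * D by exact: mulr_ge0 B0 D0.
have xq0 : 0 <= ((r / nrm z) `^ q) ^+ N by rewrite exprn_ge0// powR_ge0.
have E0 : 0 <= E by exact: mulr_ge0.
apply: le_lt_trans (opnorm_le q1 E0 _) _; last first.
  rewrite lte_fin /E powRM//.
  set x := r / nrm z in x0 *.
  suff -> : ((x `^ q) ^+ N) `^ q^-1 = x ^+ N by [].
  by rewrite -(powR_mulrn N (powR_ge0 x q)) -!powRrM mulrCA divff// mulr1 powR_mulrn.
move=> g gq; have Sq := resolvent_lq gq.
have -> : absf (fun s => resolvent g s - lambda (fun s => \sum_(n < N) c n * cfun (convpow mu n) s) g s)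
   = (fun s => ((nrm z)^-1 ^+ N)%:E * absf (T N (resolvent g)) s)%E.
  apply/funext => s; rewrite (lambda_sum q1)//.
  rewrite /absf -[X in _ - X]/(partial N g s) -{2}(resolventVK gq) partialE//.
  by rewrite opprB addrCA subrr addr0 /absf ComplexField.Normc.normcM normcX
    ComplexField.Normc.normcV EFinM.
have i0 : 0 <= (nrm z)^-1 ^+ N by rewrite exprn_ge0// invr_ge0 ltW.
rewrite qmassZ//; last by move=> s; exact: absf_ge0.
apply: le_trans.
  apply: lee_wpmul2l; first exact: poweR_ge0.
  apply: le_trans (qmass_lambda_le q1 (P N) Sq) _.
  apply: lee_pmul; [exact: opq_ge0|exact: qmass_ge0|exact: powB|exact: qmass_resolvent_le].
rewrite poweR_EFin !muleA -!EFinM; apply: lee_wpmul2r; first exact: qmass_ge0.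
have zi : 0 <= (nrm z)^-1 by rewrite invr_ge0 ltW.
rewrite lee_fin /E (powRX q N zi) (powRM _ (ltW r0) zi) exprMn.
by rewrite le_eqVlt; apply/orP; left; apply/eqP; ring.
Qed.

Lemma notin_spectrum : ~ spectrum_PF q (lambda (cfun mu)) z.
Proof.
move=> H; apply: H; exists resolvent; split; first exact: resolvent_PF.
by split => g gq; [exact: resolventK|exact: resolventVK].
Qed.

End Neumann.

(** * The spectral radius lies in the spectrum *)

Section BoundedOperators.
Context {R : realType} {G : cgroup}.
Variables (q : R) (S : op R G).
Hypothesis q1 : 1 < q.
Hypothesis bS : bounded_op q S.
Local Notation C := (R[i]).
Local Notation nrm := (@ComplexField.Normc.normc R).
Implicit Types g : G -> C.

Let q0 : 0 < q. Proof. exact: lt_trans q1. Qed.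
Let qn0 : q != 0. Proof. exact: lt0r_neq0. Qed.

(** Linearity is available in the form [a g + h]; with [a = -1] and [g = h = 0] the right side is
    [- S 0 + S 0]. *)
Lemma bounded_op0 : S (fun _ : G => 0) = fun=> 0.
Proof.
have [_ lin _] := bS; have := lin (-1) _ _ (lq_zero q1) (lq_zero q1).
rewrite (_ : (fun _ : G => -1 * 0 + 0) = fun=> 0 :> C); last first.
  by apply/funext => s; rewrite mulr0 addr0.
by move=> ->; apply/funext => s; rewrite mulN1r addNr.
Qed.

Lemma bounded_opZ (a : C) g : lq q g -> S (fun s => a * g s) = fun s => a * S g s.
Proof.
move=> gq; have [_ lin _] := bS; have := lin a _ _ gq (lq_zero q1).
rewrite (_ : (fun s : G => a * g s + 0) = fun s => a * g s); last first.
  by apply/funext => s; rewrite addr0.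
by move=> ->; apply/funext => s; rewrite bounded_op0 addr0.
Qed.

Lemma absfZ (a : C) g : absf (fun s => a * g s) = (fun s => (nrm a)%:E * absf g s)%E.
Proof. by apply/funext => s; rewrite /absf ComplexField.Normc.normcM EFinM. Qed.

Lemma bounded_op_qmass : exists2 M : R, 0 <= M & forall g, lq q g ->
  (qmass q (absf (S g)) <= M%:E * qmass q (absf g))%E.
Proof.
have [Slq _ Sfin] := bS.
have lq1 g : lq q g -> lqnorm q g <= 1 -> ((lqnorm q (S g))%:E <= opnorm q S)%E.
  by move=> gq g1; apply: ereal_sup_ubound; exists g.
have S0 : (0 <= opnorm q S)%E.
  apply: le_trans (lq1 _ (lq_zero q1) _); first by rewrite lee_fin powR_ge0.
  rewrite lqnormE (_ : absf _ = fun=> 0%E); last first.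
    by apply/funext => s; rewrite /absf ComplexField.Normc.normc0.
  by rewrite qmass0// powR0 ?invr_eq0.
have Sf : opnorm q S \is a fin_num by rewrite ge0_fin_numE.
pose M := fine (opnorm q S); have M0 : 0 <= M by rewrite fine_ge0.
exists (M `^ q); first exact: powR_ge0.
move=> g gq; have gf := qmass_fin_num gq.
have Sgf := qmass_fin_num (Slq _ gq).
have [e0|en] := eqVneq (qmass q (absf g)) 0%E.
  have -> : g = fun=> 0.
    apply/funext => s; apply: ComplexField.Normc.eq0_normc; apply: EFin_inj.
    exact: (qmass_eq0 s (absf_ge0 g) e0).
  rewrite bounded_op0 (_ : absf _ = fun=> 0%E) ?qmass0 ?mule0//.
  by apply/funext => s; rewrite /absf ComplexField.Normc.normc0.
have : (0 < qmass q (absf g))%E by rewrite lt_def en qmass_ge0.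
rewrite -(fineK gf) -(fineK Sgf); set e := fine _; set e' := fine _.
rewrite lte_fin -EFinM lee_fin => ep.
pose c := e^-1 `^ q^-1; have c0 : 0 <= c by exact: powR_ge0.
have cq : c `^ q = e^-1 by rewrite -powRrM mulVf// powRr1// invr_ge0 ltW.
pose g' s : C := (c%:C)%C * g s.
have nc : nrm (c%:C)%C = c by rewrite normc_real ger0_norm.
have mass' (h : G -> C) : (forall s, (0 <= absf h s)%E) ->
    qmass q (absf (fun s => (c%:C)%C * h s)) = (e^-1%:E * qmass q (absf h))%E.
  by move=> h0; rewrite absfZ nc qmassZ// poweR_EFin cq.
have g'q : lq q g'.
  by rewrite lqE mass'; [rewrite -(fineK gf); exact: ltry|exact: absf_ge0].
have := lq1 _ g'q; rewrite !lqnormE mass'; last exact: absf_ge0.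
rewrite -(fineK gf) -/e -EFinM mulVf ?lt0r_neq0//= powR1 => /(_ (lexx _)).
rewrite (bounded_opZ _ gq) mass'; last exact: absf_ge0.
rewrite -(fineK Sf) lee_fin -/M -(fineK Sgf) -/e' -EFinM /= => H.
have e'0 : 0 <= e' by rewrite fine_ge0// qmass_ge0.
have x0 : 0 <= e^-1 * e' by rewrite mulr_ge0// invr_ge0 ltW.
have : ((e^-1 * e') `^ q^-1) `^ q <= M `^ q.
  by apply: ge0_ler_powR; rewrite ?nnegrE ?powR_ge0// ltW.
by rewrite -powRrM mulVf// powRr1// mulrC ler_pdivrMr.
Qed.

End BoundedOperators.

Lemma sum_const_ge0 {R : realType} (x : \bar R) N : (0 <= x)%E ->
  (\sum_(n < N) x = N%:R%:E * x)%E.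
Proof.
move=> x0; elim: N => [|N IH]; first by rewrite big_ord0 mul0e.
by rewrite big_ord_recr/= IH -natr1 EFinD ge0_muleDl ?mul1e// lee_fin.
Qed.

Section PerronFrobenius.
Context {R : realType} {G : cgroup}.
Variables (q : R) (mu : G -> R) (r : R).
Hypothesis q1 : 1 < q.
Hypothesis m : prob_measure mu.
Hypothesis r0 : 0 < r.
(** This and [pow_lt] make [r^q] the exponential growth rate. The lower bound holds for every [n]
    because Fekete's limit is an infimum; the upper one comes from the limit and holds
    eventually. *)
Hypothesis pow_ge : forall n, (((r `^ q) ^+ n)%:E <= opq q (convpow mu n))%E.
Hypothesis pow_lt : forall t, r < t ->
  exists N, forall n, (N <= n)%N -> (opq q (convpow mu n) <= ((t `^ q) ^+ n)%:E)%E.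
Local Notation C := (R[i]).
Local Notation nrm := (@ComplexField.Normc.normc R).
Implicit Types f : G -> \bar R.

Let q0 : 0 < q. Proof. exact: lt_trans q1. Qed.
Let qn0 : q != 0. Proof. exact: lt0r_neq0. Qed.
Let P n : prob_measure (convpow mu n). Proof. exact: convpow_prob. Qed.
Let P0 n : nneg (convpow mu n). Proof. exact: prob_nneg. Qed.
Let m0 : nneg mu. Proof. exact: prob_nneg. Qed.

Definition hsum (t : R) N f s : \bar R :=
  (\sum_(n < N) (t^-1 ^+ n.+1)%:E * econv (convpow mu n) f s)%E.

Let coef_ge0 (t : R) n : 0 < t -> (0 <= (t^-1 ^+ n)%:E :> \bar R)%E.
Proof. by move=> t0; rewrite lee_fin exprn_ge0// invr_ge0 ltW. Qed.

Let F_ge0 n f s : (forall s, (0 <= f s)%E) -> (0 <= econv (convpow mu n) f s)%E.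
Proof. by move=> f0; exact: econv_ge0. Qed.

Let hsum_ge0 t N f s : 0 < t -> (forall s, (0 <= f s)%E) -> (0 <= hsum t N f s)%E.
Proof.
by move=> t0 f0; apply: sume_ge0 => n _; apply: mule_ge0; [exact: coef_ge0|exact: F_ge0].
Qed.

Let hsumS t N f s :
  hsum t N.+1 f s = (hsum t N f s + (t^-1 ^+ N.+1)%:E * econv (convpow mu N) f s)%E.
Proof. by rewrite /hsum big_ord_recr. Qed.

Let le_hsum_nat t N f s k : 0 < t -> (forall s, (0 <= f s)%E) ->
  (hsum t N f s <= hsum t (k + N) f s)%E.
Proof.
move=> t0 f0; elim: k => [|k IH]; first by rewrite add0n.
rewrite addSn hsumS; apply: le_trans IH _; rewrite leeDl//.
by apply: mule_ge0; [exact: coef_ge0|exact: F_ge0].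
Qed.

Let hsum_term_le t N f s n : 0 < t -> (forall s, (0 <= f s)%E) -> (n < N)%N ->
  ((t^-1 ^+ n.+1)%:E * econv (convpow mu n) f s <= hsum t N f s)%E.
Proof.
move=> t0 f0 nN; have := @le_hsum_nat t n.+1 f s (N - n.+1)%N t0 f0.
rewrite subnK//; apply: le_trans; rewrite hsumS leeDr//; exact: hsum_ge0.
Qed.

(* [(t - T) h_N = f - t^-N T^N f], with both sides moved so that no subtraction occurs. *)
Let hsum_rec t N f s : 0 < t -> (forall s, (0 <= f s)%E) ->
  (t%:E * hsum t N f s + (t^-1 ^+ N)%:E * econv (convpow mu N) f s =
   f s + econv mu (hsum t N f) s)%E.
Proof.
move=> t0 f0; elim: N => [|N IH].
  have h0 s' : hsum t 0 f s' = 0%E by rewrite /hsum big_ord0.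
  rewrite h0 mule0 add0e expr0 mul1e econv_delta// (_ : econv mu _ s = 0%E) ?adde0//.
  by apply: esum1 => t' _; rewrite h0 mule0.
have -> : econv mu (hsum t N.+1 f) s = (econv mu (hsum t N f) s +
    (t^-1 ^+ N.+1)%:E * econv (convpow mu N.+1) f s)%E.
  rewrite (_ : hsum t N.+1 f = fun s => (hsum t N f s +
     (t^-1 ^+ N.+1)%:E * econv (convpow mu N) f s)%E); last first.
    by apply/funext => s'; exact: hsumS.
  rewrite econvD//; last 2 first.
  - by move=> ?; exact: hsum_ge0.
  - by move=> ?; apply: mule_ge0; [exact: coef_ge0|exact: F_ge0].
  rewrite econvZ//; [|exact: coef_ge0|by move=> ?; exact: F_ge0].
  by rewrite econv_convpowS.
rewrite addeA -IH hsumS ge0_muleDr; last 2 first.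
- exact: hsum_ge0.
- by apply: mule_ge0; [exact: coef_ge0|exact: F_ge0].
rewrite (muleA t%:E) -EFinM.
by have -> : t * t^-1 ^+ N.+1 = t^-1 ^+ N by rewrite exprS mulrA divff ?mul1r// lt0r_neq0.
Qed.

(** In the square of the sum, the products of terms [n] and [N-1-n] are [N] copies of
    [t^-(N+1) T^(N-1) f]; all other products are nonnegative and dropped. *)
Let econv_hsum t N f s : 0 < t -> (forall s, (0 <= f s)%E) ->
  (hsum t N (hsum t N f) s >=
    (\sum_(n < N) (t^-1 ^+ N.+1)%:E * econv (convpow mu N.-1) f s))%E.
Proof.
move=> t0 f0; apply: lee_sum => n _.
have nN : (N - n.+1 < N)%N by rewrite ltn_subrL/=; case: (N) n => // -[].
apply: (@le_trans _ _ ((t^-1 ^+ n.+1)%:E * econv (convpow mu n) (fun s =>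
    (t^-1 ^+ (N - n.+1).+1)%:E * econv (convpow mu (N - n.+1)) f s) s)%E).
  rewrite econvZ//; [|exact: coef_ge0|by move=> ?; exact: F_ge0].
  rewrite -econv_convpowD// muleA -EFinM -exprD.
  have -> : (n.+1 + (N - n.+1).+1 = N.+1)%N by rewrite addnS subnKC.
  have -> // : (n + (N - n.+1) = N.-1)%N.
  by rewrite -[in RHS](subnKC (ltn_ord n)) addSn.
apply: lee_wpmul2l; first exact: coef_ge0.
by apply: le_econv => // s'; exact: hsum_term_le.
Qed.

Section Inverse.
Variable S : op R G.
Hypothesis bS : bounded_op q S.
Hypothesis SK : forall g, lq q g -> S (fun s => (r%:C)%C * g s - lambda (cfun mu) g s) = g.

(** [S] acts on complex functions; a nonnegative function of finite q-mass has finite values, so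
    [fine] is faithful on it. *)
Let rfun f : G -> C := fun s => ((fine (f s))%:C)%C.

Let absf_rfun f : (forall s, (0 <= f s)%E) -> (qmass q f < +oo)%E -> absf (rfun f) = f.
Proof.
move=> f0 fq; apply/funext => s; rewrite /absf normc_real ger0_norm ?fine_ge0// fineK//.
by rewrite ge0_fin_numE// (qmass_fin q1).
Qed.

Let lambda_rfun f s : (forall s, (0 <= f s)%E) -> (qmass q f < +oo)%E ->
  lambda (cfun mu) (rfun f) s = ((fine (econv mu f s))%:C)%C.
Proof.
move=> f0 fq.
transitivity (csumI (fun t => ((mu t * fine (f (gmul (ginv t) s)))%:C)%C)).
  by apply: eq_csumI => t; rewrite rmorphM.
rewrite csumI_ge0E; last by move=> t; rewrite mulr_ge0 ?fine_ge0.
congr ((fine _)%:C)%C; apply: eq_esum => t _; rewrite EFinM fineK//.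
by rewrite ge0_fin_numE// (qmass_fin q1).
Qed.

Let qmass_hsum_fin t N f : 0 < t -> (forall s, (0 <= f s)%E) -> (qmass q f < +oo)%E ->
  (qmass q (hsum t N f) < +oo)%E.
Proof.
move=> t0 f0 fq; elim: N => [|N IH].
  rewrite (_ : hsum t 0 f = fun=> 0%E) ?qmass0//.
  by apply/funext => s; rewrite /hsum big_ord0.
rewrite (_ : hsum t N.+1 f = fun s => (hsum t N f s +
   (t^-1 ^+ N.+1)%:E * econv (convpow mu N) f s)%E); last first.
  by apply/funext => s'; exact: hsumS.
apply: le_lt_trans (qmass_add_le q1 _ _) _.
- by move=> ?; exact: hsum_ge0.
- by move=> ?; apply: mule_ge0; [exact: coef_ge0|exact: F_ge0].
rewrite qmassZ; [|exact: coef_ge0|by move=> ?; exact: F_ge0].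
have mul_fin (a : R) (x : \bar R) : 0 <= a -> (x < +oo)%E -> (a%:E * x < +oo)%E.
  by move=> a0; exact: lte_mul_pinfty.
apply: (mul_fin); first exact: powR_ge0.
apply: lte_add_pinfty => //; rewrite poweR_EFin; apply: (mul_fin); first exact: powR_ge0.
exact: le_lt_trans (qmass_econv_prob q1 (P N) f0) fq.
Qed.

(** A priori bound, uniform in [N] and in [t] near [r]. The partial sum [H] satisfies
    [H = S ((r - T) H)], and [(r - T) H] differs from [f - t^-N T^N f] by [(t - r) H]. For [t] close
    to [r] that last term contributes at most half the q-mass of [H], which is finite and can
    therefore be absorbed. *)
Let qmass_hsum_le : exists d M : R, [/\ 0 < d, 0 <= M & forall t N f, r < t <= r + d ->
  (forall s, (0 <= f s)%E) -> (qmass q f < +oo)%E ->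
  (qmass q (hsum t N f) <= M%:E * qmass q f)%E].
Proof.
have [M0 M00 SM] := bounded_op_qmass q1 bS.
pose c := 2 `^ q : R; have c0 : 0 <= c by exact: powR_ge0.
(* Chosen so that [M0 * c / k <= 1/2]; the summand 1 keeps [k] positive when [M0 = 0]. *)
pose k := 2 * (M0 + 1) * c.
have cp : 0 < c by exact: powR_gt0.
have k0 : 0 < k by rewrite /k !mulr_gt0// ltr_wpDl.
(* [t - r <= d] means [(t - r)^q <= 1/k]. In the factor 4, one 2 counts [f] and the remainder, the
   other undoes the half lost to absorption. *)
exists (k^-1 `^ q^-1), (4 * M0 * c * c); split.
- by rewrite powR_gt0// invr_gt0.
- by rewrite !mulr_ge0.
move=> t N f /andP[rt trd] f0 fq; have t0 : 0 < t by exact: lt_trans rt.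
have [N0 HN0] := pow_lt rt.
(* [pow_lt] bounds the remainder [t^-N T^N f] from [N0] on; smaller [N] follow because the partial
   sums increase. *)
wlog NN0 : N / (N0 <= N)%N.
  move=> H; apply: le_trans (H (N0 + N)%N (leq_addr _ _)).
  by apply: le_qmass => // s; [exact: hsum_ge0|exact: le_hsum_nat].
set H := hsum t N f; pose F := econv (convpow mu N) f.
have H0 s : (0 <= H s)%E by exact: hsum_ge0.
have F0 s : (0 <= F s)%E by exact: F_ge0.
have Hq : (qmass q H < +oo)%E by exact: qmass_hsum_fin.
have Fq : (qmass q F <= ((t `^ q) ^+ N)%:E * qmass q f)%E.
  apply: le_trans (opq_bound q1 (P0 N) f0 fq) _.
  by apply: lee_wpmul2r; [exact: qmass_ge0|exact: HN0].
have Fq' : (qmass q F < +oo)%E.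
  exact: le_lt_trans (qmass_econv_prob q1 (P N) f0) fq.
have hlq : lq q (rfun H) by rewrite lqE absf_rfun.
have uabs s : (absf (fun s => (r%:C)%C * rfun H s - lambda (cfun mu) (rfun H) s)%R s <=
   (t - r)%:E * H s + (f s + (t^-1 ^+ N)%:E * F s))%E.
  rewrite /absf lambda_rfun// /rfun.
  have := hsum_rec N s t0 f0; rewrite -/H -/F.
  have Hf : H s \is a fin_num by rewrite ge0_fin_numE// (qmass_fin q1).
  have Ff : F s \is a fin_num by rewrite ge0_fin_numE// (qmass_fin q1).
  have ff : f s \is a fin_num by rewrite ge0_fin_numE// (qmass_fin q1).
  have Ef : econv mu H s \is a fin_num.
    by rewrite ge0_fin_numE ?econv_ge0//; exact: (econv_fin q1).
  move: (H0 s) (F0 s) (f0 s) Hf Ff ff Ef.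
  case: (H s) => // x; case: (F s) => // y; case: (f s) => // a; case: (econv mu H s) => // b.
  rewrite !lee_fin => x0 y0 a0 _ _ _ _ E'.
  have {}E' : t * x + t^-1 ^+ N * y = a + b by apply: EFin_inj; exact: E'.
  rewrite -[fine x%:E]/x -[fine b%:E]/b.
  have -> : (r%:C)%C * (x%:C)%C - (b%:C)%C = ((r * x - b)%:C)%C by rewrite rmorphB rmorphM.
  rewrite normc_real.
  have i0 : 0 <= t^-1 ^+ N * y by rewrite mulr_ge0// exprn_ge0// invr_ge0 ltW.
  have -> : r * x - b = - ((t - r) * x) + (a - t^-1 ^+ N * y).
    by move: E'; move: (_ * y) => w; lra.
  apply: le_trans (ler_normD _ _) _; rewrite normrN ger0_norm ?mulr_ge0 ?subr_ge0 ?(ltW rt)//.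
  by rewrite lerD2l (le_trans (ler_normB _ _))// !ger0_norm.
have u0 s : (0 <= (t - r)%:E * H s)%E by rewrite mule_ge0// lee_fin subr_ge0 ltW.
have v0 s : (0 <= (t^-1 ^+ N)%:E * F s)%E by rewrite mule_ge0// lee_fin exprn_ge0// invr_ge0 ltW.
have fv0 s : (0 <= f s + (t^-1 ^+ N)%:E * F s)%E by rewrite adde_ge0.
have := SM _ (_ : lq q (fun s => (r%:C)%C * rfun H s - lambda (cfun mu) (rfun H) s)).
rewrite SK// absf_rfun// => /(_ _) H1.
have vq : (qmass q (fun s => (t^-1 ^+ N)%:E * F s) <= qmass q f)%E.
  rewrite qmassZ//; last by rewrite lee_fin exprn_ge0// invr_ge0 ltW.
  apply: le_trans (lee_wpmul2l (poweR_ge0 _ _) Fq) _.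
  rewrite muleA poweR_EFin -EFinM (_ : _ * _ = 1) ?mul1e//.
  have ti0 : 0 <= t^-1 by rewrite invr_ge0 ltW.
  by rewrite powRX// -exprMn -powRM ?(ltW t0)// mulVf ?lt0r_neq0// powR1 expr1n.
have uq : (qmass q (absf (fun s => (r%:C)%C * rfun H s - lambda (cfun mu) (rfun H) s)%R) <=
    c%:E * (k^-1%:E * qmass q H + c%:E * (qmass q f + qmass q f)))%E.
  apply: le_trans (le_qmass q1 (absf_ge0 _) uabs) _.
  apply: le_trans (qmass_add_le q1 u0 fv0) _.
  apply: lee_wpmul2l; first by rewrite lee_fin.
  apply: leeD.
    rewrite qmassZ//; last by rewrite lee_fin subr_ge0 ltW.
    apply: lee_wpmul2r; first exact: qmass_ge0.
    rewrite poweR_EFin lee_fin -[leRHS](_ : (k^-1 `^ q^-1) `^ q = _); last first.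
      by rewrite -powRrM mulVf// powRr1// invr_ge0 ltW.
    apply: ge0_ler_powR; rewrite ?nnegrE ?powR_ge0// ?subr_ge0 ?(ltW q0) ?(ltW rt)//.
    by rewrite lerBlDl.
  apply: le_trans (qmass_add_le q1 f0 v0) _.
  apply: lee_wpmul2l; first by rewrite lee_fin.
  by rewrite leeD2l.
have ulq : lq q (fun s => (r%:C)%C * rfun H s - lambda (cfun mu) (rfun H) s).
  rewrite lqE; apply: le_lt_trans uq _.
  have Hf : qmass q H \is a fin_num by rewrite ge0_fin_numE// qmass_ge0.
  have ff : qmass q f \is a fin_num by rewrite ge0_fin_numE// qmass_ge0.
  by rewrite -(fineK Hf) -(fineK ff); exact: ltry.
have {H1} := le_trans (H1 ulq) (lee_wpmul2l (_ : (0 <= M0%:E)%E) uq).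
have Hf : qmass q H \is a fin_num by rewrite ge0_fin_numE// qmass_ge0.
have ff : qmass q f \is a fin_num by rewrite ge0_fin_numE// qmass_ge0.
move: (qmass_ge0 q H) (qmass_ge0 q f) Hf ff.
case: (qmass q H) => // x; case: (qmass q f) => // y.
rewrite -!EFinM => x0 y0 _ _ H1.
have {}H1 : x <= M0 * (c * (k^-1 * x + c * (y + y))) by exact: (H1 M00).
have half : M0 * c * k^-1 <= 2^-1.
  rewrite ler_pdivrMr// /k mulrA [2^-1 * _]mulrA mulVf// mul1r ler_wpM2r//.
  by rewrite lerDl.
have := ler_wpM2r x0 half; rewrite lee_fin.
have -> : M0 * c * k^-1 * x = M0 * (c * (k^-1 * x)) by ring.
have E1 : M0 * (c * (k^-1 * x + c * (y + y))) =
  M0 * (c * (k^-1 * x)) + 2 * (M0 * c * c * y) by ring.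
have -> : 4 * M0 * c * c * y = 4 * (M0 * c * c * y) by ring.
move: H1; rewrite E1; move: (M0 * (c * _)) (M0 * c * c * y) => u v; lra.
Qed.

(* The uniform bound survives squaring, which multiplies the N-th term by N. *)
Let power_bound : exists d M : R, [/\ 0 < d, 0 <= M & forall t N, r < t <= r + d ->
  N.+1%:R * r ^+ N <= M * t ^+ N.+2].
Proof.
have [d [M [d0 M0 HM]]] := qmass_hsum_le.
exists d, ((M * M) `^ q^-1); split => //; first exact: powR_ge0.
move=> t N td; have /andP[rt _] := td; have t0 : 0 < t by exact: lt_trans rt.
have ti0 : 0 <= t^-1 by rewrite invr_ge0 ltW.
(* The coefficient of [T^N] in the lower bound for the square of the sum with [N+1] terms. *)
pose k := N.+1%:R * t^-1 ^+ N.+2; have kp : 0 < k.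
  by rewrite mulr_gt0// exprn_gt0// invr_gt0.
have kq : 0 < k `^ q by rewrite powR_gt0.
have opN : (opq q (convpow mu N) <= ((k `^ q)^-1 * (M * M))%:E)%E.
  have cc : 0 <= (k `^ q)^-1 * (M * M) by rewrite !mulr_ge0// invr_ge0 ltW.
  apply: opq_le => // f f0 fq.
  have H1 : (qmass q (fun s => k%:E * econv (convpow mu N) f s) <= (M * M)%:E * qmass q f)%E.
    apply: (@le_trans _ _ (qmass q (hsum t N.+1 (hsum t N.+1 f)))).
      apply: le_qmass => // s.
        by rewrite mule_ge0 ?lee_fin ?(ltW kp)//; exact: F_ge0.
      apply: le_trans (econv_hsum N.+1 s t0 f0); rewrite sum_const_ge0/=.
        by rewrite /k EFinM -muleA.
      by apply: mule_ge0; [exact: coef_ge0|exact: F_ge0].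
    apply: le_trans (HM t N.+1 _ td _ _) _ => [s||]; first exact: hsum_ge0.
      exact: qmass_hsum_fin.
    by rewrite EFinM -muleA; apply: lee_wpmul2l; [rewrite lee_fin|exact: HM].
  rewrite qmassZ ?lee_fin ?(ltW kp)// in H1; last by move=> s; exact: F_ge0.
  rewrite EFinM -muleA -[leLHS]mul1e -(mulVf (lt0r_neq0 kq)) EFinM -muleA.
  by apply: lee_wpmul2l => //; rewrite lee_fin invr_ge0 ltW.
have := le_trans (pow_ge N) opN; rewrite lee_fin -powRX ?(ltW r0)//.
rewrite mulrC ler_pdivlMr// -powRM ?exprn_ge0 ?(ltW r0) ?(ltW kp)// => H.
have rk0 : 0 <= r ^+ N * k by rewrite mulr_ge0 ?exprn_ge0 ?(ltW r0) ?(ltW kp).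
have : ((r ^+ N * k) `^ q) `^ q^-1 <= (M * M) `^ q^-1.
  by apply: ge0_ler_powR => //; rewrite ?nnegrE ?powR_ge0 ?mulr_ge0// invr_ge0 ltW.
rewrite -powRrM divff// powRr1// /k mulrA exprVn ler_pdivrMr ?exprn_gt0//.
by rewrite mulrC.
Qed.

(** Letting [t] approach [r] at a speed depending on [N] keeps [(t/r)^(N+2)] bounded, so the power
    bound would make [N+1] bounded. *)
Lemma no_bounded_inverse : False.
Proof.
have [d [M [d0 M0 H]]] := power_bound.
pose K := M * r ^+ 2 * expR 1.
have K0 : 0 <= K by rewrite !mulr_ge0 ?expR_ge0 ?(ltW r0).
suff HK N : N.+1%:R <= K.
  have [n Kn] := nbhs_infty_gtr K.
  by move=> /(_ n (leqnn n)); rewrite ltNge => /negP; apply; apply: le_trans (HK n); rewrite ler_nat.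
(* The first bound keeps [t] below [r + d], the second gives [(1 + eta)^(N+2) <= e]. *)
pose eta := Num.min (d / r) N.+2%:R^-1.
have eta0 : 0 < eta by rewrite lt_min divr_gt0//= invr_gt0 ltr0n.
pose t := r * (1 + eta).
have rt : r < t <= r + d.
  rewrite /t mulrDr mulr1 ltrDl mulr_gt0//= lerD2l mulrC -ler_pdivlMr//.
  by rewrite ge_min lexx.
have := H t N rt; rewrite /t exprMn => {}H.
have : (1 + eta) ^+ N.+2 <= expR 1.
  have e1 : 1 + eta <= expR eta by exact: expR_ge1Dx.
  apply: le_trans (_ : expR eta ^+ N.+2 <= _).
    by rewrite lerXn2r// nnegrE ?expR_ge0// addr_ge0// ltW.
  rewrite -expRM_natl ler_expR.
  by rewrite mulrC -ler_pdivlMr ?ltr0n// div1r ge_min lexx orbT.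
move=> He; rewrite -(ler_pM2r (exprn_gt0 N r0)); apply: le_trans H _.
have -> : K * r ^+ N = M * (r ^+ N.+2 * expR 1) by rewrite /K !exprS; ring.
by rewrite ler_wpM2l// ler_wpM2l// exprn_ge0// ltW.
Qed.

End Inverse.

Lemma specrad_in_spectrum : spectrum_PF q (lambda (cfun mu)) (r%:C)%C.
Proof. by case=> S [[bS _] [SK _]]; exact: (no_bounded_inverse bS SK). Qed.

End PerronFrobenius.

(** * The growth rate and the theorem *)

Section SpectralRadius.
Context {R : realType} {G : cgroup}.
Variable mu : G -> R.
Hypothesis m : prob_measure mu.
Hypothesis h : finite_entropy mu.
Local Notation C := (R[i]).
Local Notation nrm := (@ComplexField.Normc.normc R).
Let P n : prob_measure (convpow mu n). Proof. exact: convpow_prob. Qed.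

Lemma shannon_convpow0 : shannon (convpow mu 0) = 0.
Proof.
rewrite /shannon /shannon_esum esum1// => s _.
by rewrite /= /delta_e; case: ifP => _; rewrite ?mul0r ?ln1 ?mulr0 oppr0.
Qed.

Lemma shannon_convpow_le n : shannon (convpow mu n) <= n%:R * shannon (convpow mu 1).
Proof.
elim: n => [|n IH]; first by rewrite shannon_convpow0 mul0r.
rewrite -add1n; apply: le_trans (shannon_convpowD 1 n m h) _.
by rewrite natrD mulrDl mul1r lerD2l.
Qed.

(* The logarithmic growth rate of [||T^n||^q], which is [q ln r(T)]. *)
Definition is_growth (q l : R) :=
  (ln (fine (opq q (convpow mu n))) / n%:R @[n --> \oo] --> l) /\
  (forall n, l * n%:R <= ln (fine (opq q (convpow mu n)))).

(** Also the source of positivity of [opq], which every later use of [ln] on it relies on. *)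
Lemma opq_convpow_ge q n : 1 < q ->
  expR (- ((q - 1) * shannon (convpow mu n))) <= fine (opq q (convpow mu n)).
Proof.
move=> q1; rewrite -lee_fin fineK ?opq_fin//.
apply: le_trans (qmass_ge_entropy q1 (P n) (convpow_entropy n m h)) _.
exact: opq_ge_qmass.
Qed.

Lemma opq_convpow_gt0 q n : 1 < q -> 0 < fine (opq q (convpow mu n)).
Proof. by move=> q1; apply: lt_le_trans (opq_convpow_ge n q1); exact: expR_gt0. Qed.

Lemma ln_opq_ge q n : 1 < q ->
  - ((q - 1) * shannon (convpow mu n)) <= ln (fine (opq q (convpow mu n))).
Proof.
move=> q1; rewrite -[leLHS]expRK ler_ln ?posrE ?expR_gt0 ?opq_convpow_gt0//.
exact: opq_convpow_ge.
Qed.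

Lemma opq_convpowD q k n : 1 < q -> fine (opq q (convpow mu (k + n))) <=
  fine (opq q (convpow mu k)) * fine (opq q (convpow mu n)).
Proof.
move=> q1; have P0 i := prob_nneg (P i).
have fine_le (x y z : \bar R) : x \is a fin_num -> y \is a fin_num -> z \is a fin_num ->
    (x <= y * z)%E -> fine x <= fine y * fine z.
  by move=> /fineK <- /fineK <- /fineK <-; rewrite -EFinM lee_fin.
apply: fine_le (opq_fin q1 (P _)) (opq_fin q1 (P _)) (opq_fin q1 (P _)) _.
apply: opq_le => [|f f0 fq].
  by rewrite mule_ge0// opq_ge0.
rewrite econv_convpowD// -muleA.
apply: le_trans (opq_bound q1 (P0 k) _ _) _.
- by move=> s; exact: econv_ge0.
- exact: le_lt_trans (qmass_econv_prob q1 (P n) f0) fq.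
by apply: lee_wpmul2l; [exact: opq_ge0|exact: opq_bound].
Qed.

(** Entropy grows at most linearly along convolution powers, which supplies the linear lower bound
    in Fekete's lemma. *)
Lemma growth_exists q : 1 < q -> exists l, is_growth q l.
Proof.
move=> q1; have gt0 n := opq_convpow_gt0 n q1.
have [|n|l [cl Hl]] := @fekete R (fun n => ln (fine (opq q (convpow mu n))))
   ((q - 1) * shannon (convpow mu 1)).
- move=> k n; rewrite -lnM ?posrE// ler_ln ?posrE ?mulr_gt0//.
  exact: opq_convpowD.
- apply: le_trans (ln_opq_ge n q1); rewrite lerN2 mulrCA ler_wpM2l ?subr_ge0 ?(ltW q1)//.
  exact: shannon_convpow_le.
exists l; split; [exact: cl|case=> [|n]; last exact: Hl].
by rewrite mulr0; have := ln_opq_ge 0 q1; rewrite shannon_convpow0 mulr0 oppr0.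
Qed.

Lemma growth_le0 q l : 1 < q -> is_growth q l -> l <= 0.
Proof.
move=> q1 [_ /(_ 1%N)]; rewrite mulr1 => /le_trans; apply; apply: ln_le0.
by rewrite -lee_fin fineK ?opq_fin// opq_prob_le1.
Qed.

Lemma specrad_growth q l : 1 < q -> is_growth q l ->
  specrad_PF q (lambda (cfun mu)) = expR (l / q).
Proof.
move=> q1 [cl Hl]; have q0 : 0 < q by exact: lt_trans q1.
have qn0 : q != 0 by exact: lt0r_neq0.
have gt0 n := opq_convpow_gt0 n q1.
set r := expR (l / q); have r0 : 0 < r by exact: expR_gt0.
have rq : r `^ q = expR l by rewrite -[r `^ q]lnK ?posrE ?powR_gt0// ln_powR expRK mulrC divfK.
have opE n : opq q (convpow mu n) = (fine (opq q (convpow mu n)))%:E by rewrite fineK ?opq_fin.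
have pow_ge n : (((r `^ q) ^+ n)%:E <= opq q (convpow mu n))%E.
  rewrite opE lee_fin rq -expRM_natl mulrC.
  by rewrite -[leRHS]lnK ?posrE// ler_expR.
have pow_lt t : r < t ->
    exists N, forall n, (N <= n)%N -> (opq q (convpow mu n) <= ((t `^ q) ^+ n)%:E)%E.
  move=> rt; have t0 : 0 < t by exact: lt_trans rt.
  have lt_l : l < q * ln t.
    by rewrite -ltr_pdivrMl// mulrC -[ltLHS]expRK ltr_ln ?posrE.
  have /cvgrPdist_lt/(_ (q * ln t - l)) := cl; rewrite subr_gt0 => /(_ lt_l)[N _ HN].
  exists N.+1 => n Nn; have := HN n (ltnW Nn).
  rewrite ltr_norml => /andP[un _].
  have np : (0 : R) < n%:R by rewrite ltr0n (leq_trans _ Nn).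
  rewrite opE lee_fin -[leLHS]lnK ?posrE// -[leRHS]lnK ?posrE ?exprn_gt0 ?powR_gt0//.
  rewrite ler_expR lnXn ?powR_gt0// ln_powR -[leRHS]mulr_natr -ler_pdivrMr// ltW//.
  by lra.
have bnd z : r < nrm z -> ~ spectrum_PF q (lambda (cfun mu)) z.
  move=> rz; pose t := (r + nrm z) / 2.
  have [rt tz] : r < t /\ t < nrm z by rewrite /t; split; lra.
  have t0 : 0 < t by exact: lt_trans rt.
  have [N HN] := pow_lt _ rt.
  have tq n : 0 < (t `^ q) ^+ n by rewrite exprn_gt0// powR_gt0.
  (* The 1 serves [n >= N]. For [n < N] the n-th summand gives [B t^(qn) >= 1], and [opq] is at most
     1. *)
  pose B := 1 + \sum_(n < N) ((t `^ q) ^+ n)^-1.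
  have S0 : 0 <= \sum_(n < N) ((t `^ q) ^+ n)^-1.
    by apply: sumr_ge0 => n _; rewrite invr_ge0 ltW.
  have B0 : 0 <= B by rewrite addr_ge0.
  apply: (@notin_spectrum R G q mu t B) => // n.
  have [Nn|nN] := leqP N n.
    apply: le_trans (HN n Nn) _; rewrite lee_fin ler_peMl ?(ltW (tq n))//.
    by rewrite /B lerDl.
  apply: le_trans (opq_prob_le1 q1 (P n)) _; rewrite lee_fin -ler_pdivrMr// div1r.
  rewrite /B (bigD1 (Ordinal nN))//= addrCA lerDl addr_ge0//.
  by apply: sumr_ge0 => k _; rewrite invr_ge0 ltW.
have rin := specrad_in_spectrum q1 m r0 pow_ge pow_lt.
rewrite /specrad_PF (_ : ereal_sup _ = r%:E)//; apply/eqP; rewrite eq_le; apply/andP; split.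
  apply: ge_ereal_sup => _ [z zs <-]; rewrite lee_fin leNgt; apply/negP => /bnd; exact.
apply: ereal_sup_ubound; exists (r%:C)%C => //.
by rewrite normc_real ger0_norm// ltW.
Qed.

Lemma rateE p l : 1 < p -> is_growth (conj_exp p) l -> rate mu p = - ((p - 1) * l).
Proof.
move=> p1 gl; have q1 : 1 < conj_exp p.
  by rewrite /conj_exp ltr_pdivlMr ?subr_gt0// mul1r gtrBl.
rewrite /rate -[lambda _]/(lambda (cfun mu)) (specrad_growth q1 gl) expRK /conj_exp.
by congr (- _); field; rewrite subr_eq0 gt_eqF//= gt_eqF// (lt_trans ltr01).
Qed.

Lemma avez_growth : exists2 l : R, avez mu = l &
  shannon (convpow mu n) / n%:R @[n --> \oo] --> l.
Proof.
have [|n|l [cl _]] := @fekete R (fun n => shannon (convpow mu n)) 0.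
- by move=> k n; exact: shannon_convpowD.
- by rewrite mulr0 oppr0 shannon_ge0.
by exists l => //; exact: cvg_lim cl.
Qed.

Lemma growth_ge_entropy q l : 1 < q -> is_growth q l -> - ((q - 1) * avez mu) <= l.
Proof.
move=> q1 [cl _]; have [a -> ca] := avez_growth.
have ca' : - (q - 1) * (shannon (convpow mu n) / n%:R) @[n --> \oo] --> - (q - 1) * a.
  by apply: cvgM => //; exact: cvg_cst.
rewrite -mulNr; apply: ler_cvg_to ca' cl _; apply: nearW => n.
by rewrite mulrA ler_wpM2r ?invr_ge0// mulNr ln_opq_ge.
Qed.

Lemma growth_interpolation q1 q2 th l1 l2 : 1 < q1 -> 1 < q2 -> 0 < th < 1 ->
  q2^-1 = 1 - th + th / q1 -> is_growth q1 l1 -> is_growth q2 l2 ->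
  l2 <= th * q2 / q1 * l1.
Proof.
move=> q11 q21 t01 e [c1 _] [c2 _]; set k := th * q2 / q1.
have c1' : k * (ln (fine (opq q1 (convpow mu n))) / n%:R) @[n --> \oo] --> k * l1.
  by apply: cvgM => //; exact: cvg_cst.
apply: ler_cvg_to c2 c1' _; apply: nearW => n.
rewrite mulrA ler_wpM2r ?invr_ge0// -ln_powR ler_ln ?posrE ?powR_gt0 ?opq_convpow_gt0//.
rewrite -lee_fin fineK ?opq_fin// -poweR_EFin fineK ?opq_fin//.
exact: opq_interpolation.
Qed.

End SpectralRadius.

Theorem theorem5p1 (R : realType) (G : cgroup) (mu : G -> R) :
  prob_measure mu -> finite_entropy mu ->
  [/\ (forall p1 p2 : R, 2 <= p1 -> p1 <= p2 -> rate mu p1 <= rate mu p2),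
      (exists M : R, forall p : R, 2 <= p -> 0 <= rate mu p <= M)
    & (exists L : R, (rate mu p @[p --> +oo] --> L) /\ L <= avez mu)].
Proof.
move=> m h.
have gt1 (p : R) : 2 <= p -> 1 < p by apply: lt_le_trans; rewrite ltr1n.
have q1 (p : R) : 2 <= p -> 1 < conj_exp p.
  by move=> /gt1 p1; rewrite /conj_exp ltr_pdivlMr ?subr_gt0// mul1r gtrBl.
have mono (p1 p2 : R) : 2 <= p1 -> p1 <= p2 -> rate mu p1 <= rate mu p2.
  move=> p12; rewrite le_eqVlt => /predU1P[->//|lt12].
  have p22 : 2 <= p2 by exact: le_trans p12 (ltW lt12).
  have [l1 g1] := growth_exists m h (q1 _ p12).
  have [l2 g2] := growth_exists m h (q1 _ p22).
  have p11 := gt1 _ p12; have p21 := gt1 _ p22.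
  rewrite (rateE m h p11 g1) (rateE m h p21 g2) lerN2.
  have n1 : p1 != 0 by rewrite gt_eqF// (lt_trans ltr01).
  have n2 : p2 != 0 by rewrite gt_eqF// (lt_trans ltr01).
  have n1' : p1 - 1 != 0 by rewrite subr_eq0 gt_eqF.
  have n2' : p2 - 1 != 0 by rewrite subr_eq0 gt_eqF.
  have p10 : 0 < p1 by exact: lt_trans p11.
  have p20 : 0 < p2 by exact: lt_trans p21.
  (* Since [1 - 1/q = 1/p], the parameter that interpolates between exponent 1 and [conj_exp p1] to
     reach [conj_exp p2] is [p1 / p2]. *)
  have th01 : 0 < p1 / p2 < 1 by rewrite divr_gt0//= ltr_pdivrMr// mul1r.
  have e : (conj_exp p2)^-1 = 1 - p1 / p2 + p1 / p2 / conj_exp p1.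
    by rewrite /conj_exp; field; rewrite n1 n2 n1' n2'.
  have := growth_interpolation m h (q1 _ p12) (q1 _ p22) th01 e g1 g2.
  (* With this factor, interpolation reads [(p2 - 1) l2 <= (p1 - 1) l1], which is monotonicity of
     the rate. *)
  have -> : p1 / p2 * conj_exp p2 / conj_exp p1 = (p1 - 1) / (p2 - 1).
    by rewrite /conj_exp; field; rewrite n1 n2 n1' n2'.
  by rewrite mulrAC ler_pdivlMr ?subr_gt0// [l2 * _]mulrC.
have bnd (p : R) : 2 <= p -> 0 <= rate mu p <= avez mu.
  move=> p2; have p1 := gt1 _ p2; have [l g] := growth_exists m h (q1 _ p2).
  have p0 : 0 < p - 1 by rewrite subr_gt0.
  rewrite (rateE m h p1 g) -mulrN mulr_ge0 ?(ltW p0) ?oppr_ge0 ?(growth_le0 m (q1 _ p2) g)//=.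
  have := growth_ge_entropy m h (q1 _ p2) g.
  (* The factor [p - 1] of the rate cancels [q - 1] exactly, so the bound by [avez mu] does not
     depend on [p]. *)
  have -> : conj_exp p - 1 = (p - 1)^-1.
    by rewrite /conj_exp; field; rewrite gt_eqF.
  by rewrite lerNl ler_pdivlMl.
split => //; first by exists (avez mu).
(* Frozen below 2, the rate becomes nondecreasing and bounded on the whole line and keeps its germ
   at infinity. The limit is then a supremum of values that are all at most [avez mu]. *)
pose f p := rate mu (Num.max p 2).
have m2 (p : R) : 2 <= Num.max p 2 by rewrite le_max lexx orbT.
have cf := @nondecreasing_cvgr R f.
exists (sup (range f)); split.
  have fE : \forall p \near +oo, f p = rate mu p.
    near=> p; rewrite /f max_l//; near: p; exact: nbhs_pinfty_ge.
  apply: cvg_trans (cf _ _).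
  - exact: near_eq_cvg.
  - by move=> x y xy; apply: mono => //; rewrite ge_max !le_max xy lexx orbT.
  - by exists (avez mu) => _ [x _ <-]; have /andP[] := bnd _ (m2 x).
apply: ge_sup; first by exists (f 0), 0.
by move=> _ [x _ <-]; have /andP[] := bnd _ (m2 x).
Unshelve. all: by end_near.
Qed.
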